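(* Let $G$ be a locally compact group. Let $\mathcal X$ be a non-empty class of Banach spaces, and let $\mathcal R$ be the class of all isometric strongly continuous representations of $G$ in spaces from $\mathcal X$. Then the map which sends $U\in\mathcal R$ to $U^{\mathcal R}$ is a bijection between $\mathcal R$ and the non-degenerate contractive representations of the Banach algebra $(\mathbb K\rtimes_{\mathrm{triv}}G)^{\mathcal R}$ in the Banach spaces from $\mathcal X$. This map preserves the set of closed invariant subspaces, as well as the Banach space of bounded intertwining operators.
   Context: $\mathbb K$ is the scalar field, $\mathbb R$ or $\mathbb C$. Locally compact groups are Hausdorff. A representation of $G$ on a Banach space $X$ is a homomorphism $r\mapsto U_r$ into the invertible elements of $B(X)$; it is isometric if every $U_r$ is an isometry. A representation of an algebra $B$ on $X$ is an algebra homomorphism $T:B\to B(X)$; it is non-degenerate if $\mathrm{span}\{T(b)x\}$ is dense in $X$, and contractive if $\|T\|\le1$. Define on $C_c(G)$ (scalar-valued functions with the usual convolution) the algebra seminorm $\sigma^{\mathcal R}(f)=\sup_{U\in\mathcal R}\|\int_Gf(s)U_s\,ds\|$, where $ds$ is a left Haar measure and the integral is taken pointwise: $x\mapsto\int_Gf(s)U_sx\,ds$. The Banach algebra $(\mathbb K\rtimes_{\mathrm{triv}}G)^{\mathcal R}$ is the completion of $C_c(G)/\ker\sigma^{\mathcal R}$ in the norm induced by $\sigma^{\mathcal R}$, and $q^{\mathcal R}:C_c(G)\to(\mathbb K\rtimes_{\mathrm{triv}}G)^{\mathcal R}$ is the canonical map. For $U\in\mathcal R$, $U^{\mathcal R}$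 is the contractive representation of $(\mathbb K\rtimes_{\mathrm{triv}}G)^{\mathcal R}$ on the space of $U$ determined by $U^{\mathcal R}(q^{\mathcal R}(f))=\int_Gf(s)U_s\,ds$ for $f\in C_c(G)$. A bounded intertwining operator between two representations is a bounded operator commuting with the two actions. *)

(* Defs.v *)
From HB Require Import structures.
From mathcomp Require Import all_boot all_order all_algebra.
From mathcomp Require Import complex.
From mathcomp Require Import all_classical all_reals all_analysis.

Set Implicit Arguments.
Unset Strict Implicit.
Unset Printing Implicit Defensive.
Import Order.TTheory GRing.Theory Num.Theory.
Import numFieldNormedType.Exports.

Local Open Scope classical_set_scope.
Local Open Scope ring_scope.

Variant scalar_kind := RealScalars | ComplexScalars.

Definition scalar_field (R : realType) (k : scalar_kind) : numFieldType :=
  match k with RealScalars => R | ComplexScalars => R[i] end.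

Section Scalars.
Variable R : realType.

Definition scalar_Re (k : scalar_kind) : scalar_field R k -> R :=
  match k return scalar_field R k -> R with
  | RealScalars => id
  | ComplexScalars => @complex.Re R
  end.

Definition scalar_Im (k : scalar_kind) : scalar_field R k -> R :=
  match k return scalar_field R k -> R with
  | RealScalars => fun=> 0
  | ComplexScalars => @complex.Im R
  end.

Definition mk_scalar (k : scalar_kind) (a b : R) : scalar_field R k :=
  match k return scalar_field R k with
  | RealScalars => a
  | ComplexScalars => Complex a b
  end.

End Scalars.

(* The point of the pointed structure is arbitrary; it is only there because
   the library builds sigma-algebras on pointed types. *)
HB.mixin Record Group_isTopological G of Group G & PointedTopological G := {
  mulg_continuous : continuous (fun p : G * G => (p.1 * p.2)%g) ;
  invg_continuous : continuous (fun x : G => (x^-1)%g)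
}.

#[short(type="topologicalGroupType")]
HB.structure Definition TopologicalGroup :=
  {G of Group G & PointedTopological G & Group_isTopological G}.

(* Banach algebras are not assumed to have a unit. *)
HB.mixin Record CompleteNormedModule_isBanachAlgebra (K : numFieldType) A
    of CompleteNormedModule K A := {
  bmul : A -> A -> A ;
  bmulA : associative bmul ;
  bmulDl : left_distributive bmul +%R ;
  bmulDr : right_distributive bmul +%R ;
  bmulZl : forall (c : K) a b, bmul (c *: a) b = c *: bmul a b ;
  bmulZr : forall (c : K) a b, bmul a (c *: b) = c *: bmul a b ;
  normr_bmul : forall a b : A, `|bmul a b| <= `|a| * `|b|
}.

#[short(type="banachAlgebraType")]
HB.structure Definition BanachAlgebra (K : numFieldType) :=
  {A of CompleteNormedModule K A & CompleteNormedModule_isBanachAlgebra K A}.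

Section Operators.
Variables (R : realType) (k : scalar_kind).
Local Notation K := (scalar_field R k).

(* The library norm of a normed K-module takes its values in K. *)
Definition rnorm (X : normedModType K) (x : X) : R := scalar_Re `|x|.

(* An extended real, so that an unbounded f has opnorm f = +oo. *)
Definition opnorm (X Y : normedModType K) (f : X -> Y) : \bar R :=
  ereal_sup [set (rnorm (f x))%:E | x in [set x : X | rnorm x <= 1]].

Definition bounded_operator (X Y : normedModType K) (f : X -> Y) : Prop :=
  linear f /\ (opnorm f < +oo)%E.

Definition invertible_operator (X : normedModType K) (f : X -> X) : Prop :=
  bounded_operator f /\
  exists2 g : X -> X, bounded_operator g & cancel f g /\ cancel g f.

Definition linear_subspace (X : normedModType K) (Y : set X) : Prop :=
  Y 0 /\ forall (c : K) x y, Y x -> Y y -> Y (c *: x + y).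

Definition linear_span (X : normedModType K) (S : set X) : set X :=
  [set y | exists n (c : 'I_n -> K) (v : 'I_n -> X),
     (forall i, S (v i)) /\ y = \sum_(i < n) c i *: v i].

(* A family of maps, indexed by S, of a Banach space into itself, bundled with
   the space; used with S a group and with S a Banach algebra.  Classes of Banach
   spaces and of representations are Prop-valued predicates instead of [set]s,
   because these types are too large for the universe of [set]. *)
Record banach_action (S : Type) := BanachAction {
  bspace : completeNormedModType K ;
  bact : S -> bspace -> bspace
}.
Arguments bact {S} b s x.

Section Actions.
Variable S : Type.

Definition closed_invariant_subspaces (u : banach_action S) : set (set (bspace u)) :=
  [set Y | [/\ closed Y, linear_subspace Y &
               forall s x, Y x -> Y (bact u s x)]].

Definition bounded_intertwiners (u v : banach_action S) : set (bspace u -> bspace v) :=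
  [set F | bounded_operator F /\
           forall s x, F (bact u s x) = bact v s (F x)].

End Actions.

Section GroupRepresentations.
Variable G : topologicalGroupType.

Definition group_representation (X : normedModType K) (U : G -> X -> X) : Prop :=
  (forall r, invertible_operator (U r)) /\
  forall r s, U (r * s)%g = U r \o U s.

Definition isometric (X : normedModType K) (U : G -> X -> X) : Prop :=
  forall r x, `|U r x| = `|x|.

Definition strongly_continuous (X : normedModType K) (U : G -> X -> X) : Prop :=
  forall x, continuous (fun r => U r x).

Definition isometric_representations
    (calX : completeNormedModType K -> Prop) (U : banach_action G) : Prop :=
  [/\ calX (bspace U), group_representation (bact U),
      isometric (bact U) & strongly_continuous (bact U)].

End GroupRepresentations.

Section AlgebraRepresentations.
Variable A : banachAlgebraType K.

Definition algebra_representation (X : normedModType K) (T : A -> X -> X) : Prop :=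
  [/\ forall a, bounded_operator (T a),
      forall (c : K) a b x, T (c *: a + b) x = c *: T a x + T b x &
      forall a b, T (bmul a b) = T a \o T b].

Definition contractive (X : normedModType K) (T : A -> X -> X) : Prop :=
  forall a, (opnorm (T a) <= (rnorm a)%:E)%E.

Definition nondegenerate (X : normedModType K) (T : A -> X -> X) : Prop :=
  dense (linear_span [set y | exists a x, y = T a x]).

Definition nondegenerate_contractive_representations
    (calX : completeNormedModType K -> Prop) (T : banach_action A) : Prop :=
  [/\ calX (bspace T), algebra_representation (bact T),
      nondegenerate (bact T) & contractive (bact T)].

End AlgebraRepresentations.

End Operators.

Arguments bact {R k S} b s x.
Arguments closed_invariant_subspaces {R k S} u _.
Arguments bounded_intertwiners {R k S} u v _.

Definition borel (G : topologicalGroupType) := g_sigma_algebraType (@open G).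

Section CrossedProduct.
Variables (R : realType) (k : scalar_kind) (G : topologicalGroupType).
Local Notation K := (scalar_field R k).
Variable mu : {measure set (borel G) -> \bar R}.

Definition left_haar_measure : Prop :=
  [/\ mu setT <> 0%E,
      forall (s : G) (B : set (borel G)), measurable B ->
        mu [set (s * r)%g | r in B] = mu B,
      forall C : set G, compact C -> (mu C < +oo)%E,
      forall B : set (borel G), measurable B ->
        mu B = ereal_inf [set mu V | V in [set V : set G | open V /\ B `<=` V]] &
      forall V : set G, open V ->
        mu V = ereal_sup [set mu C | C in [set C : set G | compact C /\ C `<=` V]]].

Definition Cc : set (G -> K) :=
  [set f | continuous f /\ compact (closure [set s | f s != 0])].

Definition scalar_integral (f : G -> K) : K :=
  mk_scalar k (\int[mu]_s scalar_Re (f s)) (\int[mu]_s scalar_Im (f s)).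

Definition convolution (f g : G -> K) : G -> K :=
  fun s => scalar_integral (fun r => f r * g (r^-1 * s)%g).

(* The weak (Pettis) integral: the vector y with phi y = \int phi (F s) ds for
   every continuous linear functional phi (unique by Hahn-Banach). *)
Definition vector_integral (X : normedModType K) (F : G -> X) : X :=
  xget 0 [set y | forall phi : {linear X -> K^o}, continuous phi ->
                    phi y = scalar_integral (fun s => phi (F s))].

Definition integrated_operator (X : normedModType K) (U : G -> X -> X)
    (f : G -> K) : X -> X :=
  fun x => vector_integral (fun s => f s *: U s x).

Definition sigma_seminorm (calR : banach_action R k G -> Prop) (f : G -> K) : \bar R :=
  ereal_sup [set r | exists2 U, calR U & r = opnorm (integrated_operator (bact U) f)].

(* A Banach algebra A with a map q, of which only the values on Cc matter, is
   a completion of Cc / ker sigma for the norm induced by sigma: q is an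
   algebra homomorphism on Cc, with dense range, carrying sigma to the norm of
   A (so that its kernel is ker sigma). *)
Definition is_crossed_product (calR : banach_action R k G -> Prop)
    (A : banachAlgebraType K) (q : (G -> K) -> A) : Prop :=
  [/\ forall (c : K) f g, Cc f -> Cc g ->
        q (fun s => c * f s + g s) = c *: q f + q g,
      forall f g, Cc f -> Cc g -> q (convolution f g) = bmul (q f) (q g),
      forall f, Cc f -> (rnorm (q f))%:E = sigma_seminorm calR f &
      dense (q @` Cc)].

Definition integrated_form (A : banachAlgebraType K) (q : (G -> K) -> A)
    (U : banach_action R k G) : banach_action R k A :=
  BanachAction
    (xget (fun _ _ => 0)
       [set T : A -> bspace U -> bspace U |
          [/\ algebra_representation T, contractive T &
              forall f, Cc f -> T (q f) = integrated_operator (bact U) f]]).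

End CrossedProduct.

(* Main.v *)
Require Import Defs.
From HB Require Import structures.
From mathcomp Require Import all_boot all_order all_algebra.
From mathcomp Require Import complex ring lra.
From mathcomp Require Import all_classical all_reals all_analysis measurable_realfun.
Set Implicit Arguments.
Unset Strict Implicit.
Unset Printing Implicit Defensive.
Import Order.TTheory GRing.Theory Num.Theory.
Import numFieldNormedType.Exports.
Local Open Scope classical_set_scope.
Local Open Scope ring_scope.

(** One direction of the bijection sends an isometric strongly continuous
    representation U to the extension by continuity of
    q f |-> U(f) = \int f(s) U_s ds, which exists because the norm of q f is the
    supremum of the norms of the operators U(f). The way back rests
    on approximate units: if u is a probability density concentrated near 1 and
    u_r is its translate by r, then U(u_r) x tends to U_r x. So U can be read off
    from its integrated form, and U and its integrated form have the same closed
    invariant subspaces and the same bounded intertwining operators.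

    Let T be a non-degenerate contractive representation of the algebra. Then
    U_r y is defined as the limit of T (q u_r) y. The limit exists on the vectors
    T (q f) x, because q u_r * q f tends to q of the translate of f
    (approximate_unit); it exists on all vectors, because the norm of q u_r is at
    most the L1-norm 1 of u_r and T is non-degenerate. The formula
    U_r (T (q f) x) = T (q (f translated by r)) x gives the group law, hence
    isometry, and strong continuity. Finally q f * q g is the integral in A of
    f(r) times q of g translated by r (q_convolution_integral); applying T to
    this identity shows that the integrated form of U is T. The identity itself
    can be checked after applying the integrated forms, as these separate the
    points of A (crossed_product_separation).

    Two tools carry the analysis. The Hahn-Banach theorem makes weak integrals
    unique and bounds them in norm. The lemma quadrature approximates the Haar
    integrals of all functions with a common modulus of continuity on a compact
    set by one finite weighted sum; it gives the existence of weak integrals in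
    Banach spaces, and the exchange of integrals behind U(f * g) = U(f) U(g). *)

(** * Scalars and norms *)

Section Scalars.
Variables (R : realType) (k : scalar_kind).
Local Notation K := (scalar_field R k).
Local Notation Re := (@scalar_Re R k).
Local Notation Im := (@scalar_Im R k).

Definition real_scalar (a : R) : K := mk_scalar k a 0.

(** Minus the imaginary unit over C, and 0 over R: over both fields it expresses
    imaginary parts as real parts (Im_Re_negI), so that only real functionals
    and real integrals have to be studied. *)
Definition negI : K := mk_scalar k 0 (-1).
Local Notation rc := real_scalar.

Lemma scalar_ext (z w : K) : Re z = Re w -> Im z = Im w -> z = w.
Proof. by rewrite /rc; case: k z w => //= -[a b] [c d] /= -> ->. Qed.

Lemma Re_mk (a b : R) : Re (mk_scalar k a b) = a.
Proof. by case: k. Qed.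

Lemma Im_mk (a b : R) : (k = RealScalars -> b = 0) -> Im (mk_scalar k a b) = b.
Proof. by case: k => // ->. Qed.
Lemma negI_real : k = RealScalars -> negI = 0.
Proof. by rewrite /negI; case: k. Qed.

Lemma Re_rc (a : R) : Re (rc a) = a.
Proof. exact: Re_mk. Qed.

Lemma Re_add (z w : K) : Re (z + w) = Re z + Re w.
Proof. by case: k z w => //= -[a b] [c d]. Qed.
Lemma Im_add (z w : K) : Im (z + w) = Im z + Im w.
Proof. by case: k z w => [? ?|[a b] [c d]] //=; rewrite addr0. Qed.
Lemma Re_opp (z : K) : Re (- z) = - Re z.
Proof. by case: k z => //= -[a b]. Qed.
Lemma Re_zero : Re 0 = 0.
Proof. by case: k. Qed.
Lemma Re_sub (z w : K) : Re (z - w) = Re z - Re w.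
Proof. by rewrite Re_add Re_opp. Qed.
Lemma Re_mul (z w : K) : Re (z * w) = Re z * Re w - Im z * Im w.
Proof. by case: k z w => [? ?|[a b] [c d]] //=; rewrite mul0r subr0. Qed.
Lemma Im_mul (z w : K) : Im (z * w) = Re z * Im w + Im z * Re w.
Proof. by case: k z w => [? ?|[a b] [c d]] //=; rewrite mulr0 mul0r addr0. Qed.
Lemma Im_Re_negI (z : K) : Im z = Re (negI * z).
Proof.
rewrite /negI; case: k z => [?|[a b]] //=; first by rewrite mul0r.
by rewrite mul0r sub0r mulN1r opprK.
Qed.
Lemma Im_rc (a : R) : Im (rc a) = 0.
Proof. by rewrite /rc; case: k. Qed.
Lemma negI_mul (c : K) : negI * c = rc (Im c) + rc (Re c) * negI.
Proof.
rewrite /negI /rc; case: k c => [?|[a b]] /=; first by rewrite mulr0 mul0r addr0.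
by apply/eqP; rewrite eq_complex /=; apply/andP; split; apply/eqP; ring.
Qed.
Lemma scalar_decomp (c : K) : c = rc (Re c) - rc (Im c) * negI.
Proof.
rewrite /negI /rc; case: k c => [?|[a b]] /=; first by rewrite mulr0 subr0.
by apply/eqP; rewrite eq_complex /=; apply/andP; split; apply/eqP; ring.
Qed.
Lemma rcD (a b : R) : rc (a + b) = rc a + rc b.
Proof. by apply: scalar_ext; rewrite ?Re_add ?Im_add ?Re_rc ?Im_rc ?addr0. Qed.
Lemma rcN (a : R) : rc (- a) = - rc a.
Proof. by apply/eqP; rewrite -addr_eq0 -rcD addNr /rc; case: k. Qed.
Lemma rcB (a b : R) : rc (a - b) = rc a - rc b.
Proof. by rewrite rcD rcN. Qed.
Lemma rcM (a b : R) : rc (a * b) = rc a * rc b.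
Proof. by apply: scalar_ext; rewrite ?Re_mul ?Im_mul ?Re_rc ?Im_rc ?(mulr0, mul0r, subr0, addr0). Qed.
Lemma rc1 : rc 1 = 1. Proof. by rewrite /rc; case: k. Qed.
Lemma rc0 : rc 0 = 0. Proof. by rewrite /rc; case: k. Qed.
Lemma Re_rcM (a : R) (z : K) : Re (rc a * z) = a * Re z.
Proof. by rewrite Re_mul Re_rc Im_rc mul0r subr0. Qed.

Lemma le_rc (a b : R) : (rc a <= rc b) = (a <= b).
Proof. by rewrite /rc; case: k => //=; rewrite lecE eqxx. Qed.
Lemma lt_rc (a b : R) : (rc a < rc b) = (a < b).
Proof. by rewrite /rc; case: k => //=; rewrite ltcE eqxx. Qed.
Lemma ge0_rc (z : K) : 0 <= z -> z = rc (Re z).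
Proof.
by rewrite /rc; case: k z => //= -[a b]; rewrite lecE => /andP[/= /eqP-> _].
Qed.

Definition sabs (c : K) : R := Re `|c|.

Lemma sabs_rc (a : R) : sabs (rc a) = `|a|.
Proof.
rewrite /sabs /rc; case: k => //=.
by rewrite expr0n addr0 sqrtr_sqr.
Qed.

Lemma Re_le_sabs (z : K) : Re z <= sabs z.
Proof.
rewrite /sabs; case: k z => [?|[a b]] /=; first exact: ler_norm.
apply: (le_trans (ler_norm a)); rewrite -sqrtr_sqr ler_sqrt.
  by rewrite lerDl sqr_ge0.
by rewrite addr_ge0 ?sqr_ge0.
Qed.

Lemma sabs_le (z : K) : sabs z <= `|Re z| + `|Im z|.
Proof.
rewrite /sabs; case: k z => [?|[a b]] /=; first by rewrite normr0 addr0.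
have h : 0 <= `|a| + `|b| by rewrite addr_ge0.
rewrite -[leRHS](ger0_norm h) -(sqrtr_sqr (`|a| + `|b|)) ler_sqrt ?sqr_ge0 //.
rewrite sqrrD !real_normK ?num_real // -addrA lerD2l lerDr.
by rewrite mulrn_wge0 // mulr_ge0.
Qed.

Lemma sabs_ge0 (z : K) : 0 <= sabs z.
Proof. by rewrite -le_rc rc0 -ge0_rc. Qed.
Lemma sabs_negI : sabs negI <= 1.
Proof.
rewrite /sabs /negI; case: k => /=; first by rewrite normr0.
by rewrite expr0n add0r sqrrN expr1n sqrtr1.
Qed.

Lemma abs_Re_le (z : K) : `|Re z| <= sabs z.
Proof.
rewrite ler_norml Re_le_sabs andbT lerNl -Re_opp; apply: le_trans (Re_le_sabs _) _.
by rewrite /sabs normrN.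
Qed.

Section Norm.
Variable X : normedModType K.
Implicit Types x y : X.

Lemma normE x : `|x| = rc (rnorm x).
Proof. by rewrite {1}(ge0_rc (normr_ge0 x)). Qed.
Lemma rnorm_ge0 x : 0 <= rnorm x.
Proof. by rewrite -le_rc rc0 -normE. Qed.
Lemma rnormD x y : rnorm (x + y) <= rnorm x + rnorm y.
Proof. by rewrite -le_rc rcD -!normE ler_normD. Qed.
Lemma rnormN x : rnorm (- x) = rnorm x.
Proof. by rewrite /rnorm normrN. Qed.
Lemma rnormBC x y : rnorm (x - y) = rnorm (y - x).
Proof. by rewrite -rnormN opprB. Qed.
Lemma rnorm0 : rnorm (0 : X) = 0.
Proof. by rewrite /rnorm normr0 Re_zero. Qed.
Lemma rnorm_eq0 x : rnorm x = 0 -> x = 0.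
Proof. by move=> h; apply/eqP; rewrite -normr_eq0 normE h rc0. Qed.
Lemma rnormZ (c : K) x : rnorm (c *: x) = sabs c * rnorm x.
Proof.
by rewrite /rnorm normrZ /sabs -Re_rcM -ge0_rc ?normr_ge0.
Qed.
Lemma rnorm_rcZ (t : R) x : 0 < t -> rnorm (rc t *: x) = t * rnorm x.
Proof. by move=> t0; rewrite rnormZ sabs_rc gtr0_norm. Qed.
Lemma rnorm_negI x : rnorm (negI *: x) <= rnorm x.
Proof. by rewrite rnormZ ler_piMl ?rnorm_ge0 ?sabs_negI. Qed.
Lemma rnorm_tri (y x z : X) : rnorm (x - z) <= rnorm (x - y) + rnorm (y - z).
Proof. by rewrite (le_trans _ (rnormD _ _)) // addrA subrK. Qed.
Lemma rnorm_dist x y : `|rnorm x - rnorm y| <= rnorm (x - y).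
Proof.
have := rnorm_tri y x 0; have := rnorm_tri x y 0; rewrite !subr0 (rnormBC y) => h1 h2.
by rewrite ler_norml; apply/andP; split; lra.
Qed.
Lemma rnorm_small x : (forall e, 0 < e -> rnorm x <= e) -> x = 0.
Proof.
by move=> h; apply: rnorm_eq0; apply/eqP; rewrite eq_le rnorm_ge0 andbT;
  apply/ler_addgt0Pr => e /h; rewrite add0r.
Qed.

(** The topology is defined through a norm with values in K; from here on only
    the real-valued norm is used. *)
Lemma nbhs_rnormP x (P : set X) :
  nbhs x P <-> exists2 e : R, 0 < e & forall y, rnorm (x - y) < e -> P y.
Proof.
split => [/nbhs_ballP[e /= e0 h]|[e e0 h]].
  have eE : e = rc (Re e) by apply: ge0_rc; exact: ltW.
  exists (Re e); first by rewrite -lt_rc rc0 -eE.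
  by move=> y xy; apply: h; rewrite -ball_normE /= normE eE lt_rc.
apply/nbhs_ballP; exists (rc e) => /=; first by rewrite -rc0 lt_rc.
by move=> y; rewrite -ball_normE /= normE lt_rc; exact: h.
Qed.

Lemma closed_rnorm (Y : set X) x : closed Y ->
  (forall e, 0 < e -> exists2 y, Y y & rnorm (x - y) < e) -> Y x.
Proof.
move=> cY h; apply: cY => P /nbhs_rnormP[e e0 eP].
by have [y Yy xy] := h e e0; exists y; split => //; exact: eP.
Qed.

Lemma dense_rnormP (Y : set X) :
  dense Y <-> forall x e, 0 < e -> exists2 y, Y y & rnorm (x - y) < e.
Proof.
split=> [dY x e e0|h O [x Ox] oO].
  have nx : nbhs x [set y | rnorm (x - y) < e].
    by apply/nbhs_rnormP; exists e.
  have [|y [/interior_subset yx Yy]] := dY (interior [set y | rnorm (x - y) < e]) _ (open_interior _).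
    by exists x.
  by exists y.
have /nbhs_rnormP[e e0 eO] : nbhs x O by exact: open_nbhs_nbhs.
by have [y Yy xy] := h x e e0; exists y; split => //; exact: eO.
Qed.

Lemma cvg_rnormP (T : topologicalType) (f : T -> X) (t : T) :
  f @ t --> f t <-> forall e, 0 < e -> \forall s \near t, rnorm (f t - f s) < e.
Proof.
split => [ft e e0|h P /nbhs_rnormP[e e0 eP]].
  by apply: (ft [set y | rnorm (f t - y) < e]); apply/nbhs_rnormP; exists e.
by apply: filterS (h e e0) => s; exact: eP.
Qed.

Lemma cauchy_rnorm (F : set_system X) : ProperFilter F ->
  (forall e, 0 < e -> exists x, F [set y | rnorm (x - y) < e]) -> cauchy F.
Proof.
move=> FF h; apply: cauchy_exP => e e0.
have eE : e = rc (Re e) by apply: ge0_rc; exact: ltW.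
have [|x Fx] := h (Re e); first by rewrite -lt_rc rc0 -eE.
exists x; apply: filterS Fx => y /=.
by rewrite -ball_normE /= normE eE lt_rc Re_rc.
Qed.
End Norm.

Lemma sabs_dist (z w : K) : `|sabs z - sabs w| <= sabs (z - w).
Proof. exact: (@rnorm_dist K^o z w). Qed.

(** Completeness in the form in which limits are constructed below: P e is the
    set of candidates at precision e, and no sequence of candidates is chosen. *)
Lemma complete_approx (X : completeNormedModType K) (P : R -> set X) :
  (forall e, 0 < e -> P e !=set0) ->
  (forall e e' x y, 0 < e -> 0 < e' -> P e x -> P e' y -> rnorm (x - y) <= e + e') ->
  exists l, forall e x, 0 < e -> P e x -> rnorm (x - l) <= e.
Proof.
move=> P0 PP.
pose F := filter_from [set e : R | 0 < e]
  (fun e => [set x | exists2 e', 0 < e' <= e & P e' x]).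
have FF : ProperFilter F.
  apply: filter_from_proper; last first.
    by move=> e e0; have [x Px] := P0 e e0; exists x, e => //; rewrite e0 lexx.
  apply: filter_from_filter; first by exists 1; exact: ltr01.
  move=> a b a0 b0; exists (Order.min a b) => /=; first by rewrite lt_min a0.
  by move=> x [e /andP[e0]]; rewrite le_min => /andP[ea eb] Px; split; exists e;
    rewrite ?e0.
have /cauchy_cvg : cauchy F.
  apply: cauchy_rnorm => e e0.
  have e30 : 0 < e / 3 by rewrite divr_gt0.
  have [x Px] := P0 _ e30; exists x, (e / 3) => // y [e' /andP[e'0 e'e] Py].
  by rewrite /= (le_lt_trans (PP _ _ _ _ _ _ Px Py)) //; lra.
move=> /cvg_ex[l Fl]; exists l => e x e0 Px.
apply/ler_addgt0Pr => d d0.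
have d20 : 0 < d / 2 by rewrite divr_gt0.
have : F [set y | rnorm (l - y) < d / 2].
  by apply: (Fl [set y | rnorm (l - y) < d / 2]); apply/nbhs_rnormP; exists (d / 2).
have : F [set y | exists2 e', 0 < e' <= d / 2 & P e' y] by exists (d / 2).
move=> FA FB; have [y [[e' /andP[e'0 e'd] Py] /= ly]] := filter_ex (filterI FA FB).
rewrite (le_trans (rnorm_tri y _ _)) // (rnormBC y).
by have := PP _ _ _ _ e0 e'0 Px Py; lra.
Qed.

Section Operators.
Variables X Y : normedModType K.

Lemma scale_unit_ball (x : X) (e : R) : 0 < e ->
  rnorm (rc (rnorm x + e)^-1 *: x) <= 1.
Proof.
move=> e0; have n0 := rnorm_ge0 x.
have h : 0 < rnorm x + e by lra.
have hi : 0 <= (rnorm x + e)^-1 by rewrite invr_ge0 ltW.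
by rewrite rnormZ sabs_rc (ger0_norm hi) ler_pdivrMl // mulr1 lerDl ltW.
Qed.

(** The unit ball controls f x by rescaling x; the rescaling factor uses
    rnorm x + e because rnorm x may vanish. *)
Lemma opnorm_le (f : X -> Y) (M : R) : (forall c x, f (c *: x) = c *: f x) ->
  0 <= M ->
  (opnorm f <= M%:E)%E <-> forall x, rnorm (f x) <= M * rnorm x.
Proof.
move=> fZ M0; split=> [h x|h]; last first.
  apply: ge_ereal_sup => _ [x /= x1 <-]; rewrite lee_fin (le_trans (h x)) //.
  by rewrite ler_piMr.
apply/ler_addgt0Pr => e e0; have n0 := rnorm_ge0 x.
have d0 : 0 < e / (M + 1) by rewrite divr_gt0 //; lra.
set d := e / (M + 1) in d0.
have h0 : 0 < rnorm x + d by lra.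
have : rnorm (f (rc (rnorm x + d)^-1 *: x)) <= M.
  rewrite -lee_fin; apply: le_trans h; apply: ereal_sup_ubound.
  by exists (rc (rnorm x + d)^-1 *: x) => //; exact: scale_unit_ball.
have hi : 0 <= (rnorm x + d)^-1 by rewrite invr_ge0 ltW.
rewrite fZ rnormZ sabs_rc (ger0_norm hi) ler_pdivrMl // => hh.
apply: (le_trans hh); rewrite mulrDl (mulrC _ M) lerD2l.
rewrite /d mulrAC ler_pdivrMr; last by lra.
by rewrite ler_pM2l //; lra.
Qed.

Lemma linear_0 (f : X -> Y) : linear f -> f 0 = 0.
Proof. by move=> lf; have := lf (-1) 0 0; rewrite scaler0 addr0 scaleN1r addNr. Qed.
Lemma linear_scale (f : X -> Y) : linear f -> forall c x, f (c *: x) = c *: f x.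
Proof.
move=> lf c x; have f0 := linear_0 lf.
by rewrite -[c *: x]addr0 lf f0 addr0.
Qed.
Lemma linear_sub (f : X -> Y) : linear f -> forall x y, f (x - y) = f x - f y.
Proof. by move=> lf x y; rewrite addrC -scaleN1r lf scaleN1r addrC. Qed.

Lemma bounded_operatorP (f : X -> Y) : bounded_operator f <->
  linear f /\ exists2 M : R, 0 <= M & forall x, rnorm (f x) <= M * rnorm x.
Proof.
split=> [[lf h]|[lf [M M0 h]]]; split => //.
  have h0 : (0 <= opnorm f)%E.
    apply: ereal_sup_ubound; exists 0; first by rewrite /= rnorm0.
    by rewrite (linear_0 lf) rnorm0.
  have fE : opnorm f = (fine (opnorm f))%:E by rewrite fineK // ge0_fin_numE.
  have f0 : 0 <= fine (opnorm f) by rewrite fine_ge0.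
  exists (fine (opnorm f)) => //.
  by apply: (iffLR (opnorm_le (linear_scale lf) f0)); rewrite -fE.
apply: (@le_lt_trans _ _ M%:E); last exact: ltry.
exact: (iffRL (opnorm_le (linear_scale lf) M0)).
Qed.

Lemma bounded_continuous (f : X -> Y) M : (forall x y, rnorm (f x - f y) <= M * rnorm (x - y)) ->
  continuous f.
Proof.
move=> h x; apply/cvg_rnormP => e e0; apply/nbhs_rnormP.
have M0 : 0 < `|M| + 1 by have := normr_ge0 M; lra.
exists (e / (`|M| + 1)); first by rewrite divr_gt0.
move=> y; rewrite ltr_pdivlMr // => xy; apply: le_lt_trans (h _ _) _.
apply: le_lt_trans xy; rewrite mulrC ler_wpM2l ?rnorm_ge0 //.
by have := ler_norm M; lra.
Qed.

Lemma linear_continuous_bound (f : X -> Y) : linear f -> continuous f ->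
  exists2 M : R, 0 <= M & forall x, rnorm (f x) <= M * rnorm x.
Proof.
move=> lf cf; have f0 := linear_0 lf.
have /cvg_rnormP/(_ 1 ltr01)/nbhs_rnormP[e e0 h] := cf 0.
have e20 : 0 < e / 2 by rewrite divr_gt0.
exists (e / 2)^-1; first by rewrite invr_ge0 ltW.
have i0 : 0 <= (e / 2)^-1 by rewrite invr_ge0 ltW.
apply: (iffLR (opnorm_le (linear_scale lf) i0)).
apply: ge_ereal_sup => _ [x /= x1 <-]; rewrite lee_fin.
have := h (rc (e/2) *: x).
rewrite f0 !sub0r !rnormN (linear_scale lf) !rnormZ sabs_rc ger0_norm; last exact: ltW.
rewrite -[(e / 2)^-1]mulr1 ler_pdivlMl // => hh; apply/ltW/hh.
by apply: (@le_lt_trans _ _ (e/2)); [rewrite ler_piMr // ltW|lra].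
Qed.
End Operators.
End Scalars.

(** * The Hahn-Banach theorem *)

Section HahnBanach.
Variables (R : realType) (k : scalar_kind).
Local Notation K := (scalar_field R k).
Local Notation Re := (@scalar_Re R k).
Local Notation Im := (@scalar_Im R k).
Local Notation rc := (@real_scalar R k).
Local Notation nI := (@negI R k).
Variable X : normedModType K.

Section Real.
Variable y : X.

(** Graphs of real-linear functionals dominated by the norm. Domination forces a
    subspace of X * R to be a graph: if it contains (0, a) it contains (0, - a),
    so a <= 0 and - a <= 0. The last clause puts y into the domain of every nonempty graph and
    still admits the empty chain. *)
Let good (G : set (X * R)) :=
  [/\ forall p q s t, G p -> G q ->
        G (rc s *: p.1 + rc t *: q.1, s * p.2 + t * q.2),
      forall p, G p -> p.2 <= rnorm p.1
    & forall p, G p -> G (y, rnorm y)].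

Let good_bigcup (F : set (set (X * R))) :
  F `<=` good -> total_on F subset -> good (\bigcup_(A in F) A).
Proof.
move=> Fg Ft; split.
- move=> p q s t [A FA Ap] [B FB Bq].
  have [AB|BA] := Ft _ _ FA FB.
    by exists B => //; have [h _ _] := Fg _ FB; apply: h => //; exact: AB.
  by exists A => //; have [h _ _] := Fg _ FA; apply: h => //; exact: BA.
- by move=> p [A FA Ap]; have [_ h _] := Fg _ FA; exact: h.
- by move=> p [A FA Ap]; exists A => //; have [_ _ h] := Fg _ FA; exact: h Ap.
Qed.

Let good_line : good [set p | exists t, p = (rc t *: y, t * rnorm y)].
Proof.
split => [p q s t [a ->] [b ->]|p [a ->]|p [a _]] /=.
- exists (s * a + t * b).
  by rewrite !scalerA -scalerDl !rcD !rcM mulrDl !mulrA.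
- by rewrite rnormZ sabs_rc ler_wpM2r ?rnorm_ge0 // ler_norm.
- by exists 1; rewrite rc1 scale1r mul1r.
Qed.

(** The value c at the new vector x has to lie between the numbers
    a - |u - x| and the numbers |v + x| - b for (u, a) and (v, b) in the graph;
    such a c exists because a + b <= |u + v| <= |u - x| + |v + x|. *)
Let good_extend (A : set (X * R)) (x : X) : good A -> A !=set0 ->
  exists c, good [set p | exists u a t, A (u, a) /\ p = (u + rc t *: x, a + t * c)].
Proof.
move=> [Al An Ay] [p0 Ap0].
pose S := [set z | exists u a, A (u, a) /\ z = a - rnorm (u - x)].
have SS z v b : S z -> A (v, b) -> z <= rnorm (v + x) - b.
  move=> [u [a [Aua ->]]] Avb.
  have := An _ (Al _ _ 1 1 Aua Avb); rewrite /= rc1 !scale1r !mul1r => h.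
  have := rnormD (u - x) (v + x); rewrite addrACA addNr addr0; lra.
have S0 : S !=set0 by case: p0 Ap0 => u a Aua; exists (a - rnorm (u - x)), u, a.
have Sub : has_ubound S.
  by case: p0 Ap0 => v b Avb; exists (rnorm (v + x) - b) => z Sz; exact: SS.
pose c := sup S.
have c_ge u a : A (u, a) -> a - rnorm (u - x) <= c.
  by move=> Aua; apply: ub_le_sup => //; exists u, a.
have c_le v b : A (v, b) -> c <= rnorm (v + x) - b.
  by move=> Avb; apply: ge_sup => // z Sz; exact: SS.
have Asc u a s : A (u, a) -> A (rc s *: u, s * a).
  by move=> Aua; have := Al _ _ s 0 Aua Aua; rewrite /= rc0 scale0r mul0r !addr0.
exists c; split.
- move=> p q s t [u [a [r [Au ->]]]] [v [b [r' [Av ->]]]].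
  exists (rc s *: u + rc t *: v), (s * a + t * b), (s * r + t * r'); split.
    exact: (Al _ _ s t Au Av).
  rewrite /= !scalerDr !scalerA addrACA -scalerDl rcD !rcM; congr pair.
  by ring.
- move=> p [u [a [t [Au ->]]]] /=.
  have [t0|t0|->] := ltgtP t 0; last first.
  + by rewrite rc0 scale0r mul0r !addr0; exact: (An _ Au).
  + have := c_le _ _ (Asc _ _ t^-1 Au).
    rewrite -(ler_pM2l t0) mulrBr mulrA divff ?gt_eqF // mul1r => h.
    suff : t * rnorm (rc t^-1 *: u + x) = rnorm (u + rc t *: x) by lra.
    rewrite -rnorm_rcZ // scalerDr scalerA -rcM divff ?gt_eqF //.
    by rewrite rc1 scale1r.
  + have s0 : 0 < - t by lra.
    have := c_ge _ _ (Asc _ _ (- t)^-1 Au).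
    rewrite -(ler_pM2l s0) mulrBr mulrA divff ?gt_eqF // mul1r => h.
    suff : - t * rnorm (rc (-t)^-1 *: u - x) = rnorm (u + rc t *: x) by lra.
    rewrite -rnorm_rcZ // scalerBr scalerA -rcM divff ?gt_eqF //.
    by rewrite rc1 scale1r rcN scaleNr opprK.
- move=> p _; exists y, (rnorm y), 0; split; first exact: Ay Ap0.
  by rewrite rc0 scale0r mul0r !addr0.
Qed.

Lemma real_hahn_banach : exists g : X -> R,
  [/\ forall s t u v, g (rc s *: u + rc t *: v) = s * g u + t * g v,
      forall x, g x <= rnorm x & g y = rnorm y].
Proof.
have [A [gA Amax]] := Zorn_bigcup good_bigcup.
have [Al An Ay] := gA.
have A0 : A !=set0.
  apply/set0P/negP => /eqP A0; apply: (Amax _ _ good_line); split.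
    by rewrite A0.
  by rewrite A0 => /(_ (rc 0 *: y, 0 * rnorm y)) /=; apply; exists 0.
have [p0 Ap0] := A0.
have A00 : A (0, 0).
  by have := Al _ _ 0 0 Ap0 Ap0; rewrite /= rc0 !scale0r !mul0r !addr0.
have Atot x : exists a, A (x, a).
  apply: contrapT => nx; have [c gB] := good_extend x gA A0.
  apply: (Amax _ _ gB); split.
    by move=> [u a] Aua; exists u, a, 0; rewrite rc0 scale0r mul0r !addr0.
  move=> BA; apply: nx; exists c; apply: BA; exists 0, 0, 1.
  by rewrite rc1 scale1r mul1r !add0r.
have Ale x a b : A (x, a) -> A (x, b) -> a <= b.
  move=> Aa Ab; have := An _ (Al _ _ 1 (-1) Aa Ab) => /=.
  by rewrite rcN rc1 scale1r scaleN1r subrr rnorm0; lra.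
have /choice[g gP] := Atot; exists g; split.
- move=> s t u v; apply/eqP; rewrite eq_le; apply/andP.
  by split; (apply: Ale; [|apply: gP || exact: (Al _ _ s t (gP u) (gP v))]);
   (apply: gP || exact: (Al _ _ s t (gP u) (gP v))).
- by move=> x; exact: (An _ (gP x)).
- have Ayy := Ay _ Ap0; apply/eqP; rewrite eq_le.
  by rewrite (Ale _ _ _ (gP y) Ayy) (Ale _ _ _ Ayy (gP y)).
Qed.
End Real.

(** Over C, a functional is determined by its real part g: its value at x is
    g x + i g (- i x). The estimates of integrals only use that the real part
    is bounded by the norm. *)
Lemma hahn_banach (y : X) : exists phi : {linear X -> K^o},
  [/\ continuous phi, forall x, Re (phi x) <= rnorm x & Re (phi y) = rnorm y].
Proof.
have [g [gl gn gy]] := real_hahn_banach y.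
have g_add u v : g (u + v) = g u + g v.
  by have := gl 1 1 u v; rewrite rc1 !scale1r !mul1r.
have g_scale s u : g (rc s *: u) = s * g u.
  by have := gl s 0 u u; rewrite rc0 scale0r mul0r !addr0.
have gN u : g (- u) = - g u.
  by rewrite -scaleN1r -rc1 -rcN g_scale mulN1r.
pose f (x : X) : K^o := mk_scalar k (g x) (g (nI *: x)).
have Ref x : Re (f x) = g x by exact: Re_mk.
have Imf x : Im (f x) = g (nI *: x).
  apply: Im_mk => kR; rewrite (negI_real R kR).
  by rewrite scale0r -(scale0r (0 : X)) -[0 in LHS](rc0 R k) g_scale mul0r.
have fl : linear f.
  move=> c u v; rewrite -[c *: f u]/(c * f u : K); apply: scalar_ext.
    rewrite Re_add Re_mul Ref !Imf !Ref [in LHS](scalar_decomp c) g_add; congr (_ + _).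
    by rewrite scalerBl g_add gN -scalerA !g_scale.
  rewrite Im_add Im_mul Imf !Imf !Ref scalerDr g_add; congr (_ + _).
  by rewrite scalerA negI_mul scalerDl g_add -scalerA !g_scale addrC.
pose phi : {linear X -> K^o} := HB.pack f (GRing.isLinear.Build _ _ _ _ f fl).
have g_abs u : `|g u| <= rnorm u.
  by rewrite ler_norml gn -(rnormN u) lerNl -gN gn.
exists phi; split => // [|x|]; last 2 first.
- by rewrite Ref.
- by rewrite Ref.
apply: (@bounded_continuous _ _ _ _ _ 2) => u v.
rewrite -(linear_sub fl).
set w := u - v.
rewrite /phi /=.
have := sabs_le (f w); rewrite Ref Imf.
have := g_abs w; have := g_abs (nI *: w); have := rnorm_negI w.
by rewrite -[rnorm (f w)]/(sabs (f w)); lra.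
Qed.

Definition scale_functional (c : K) (phi : {linear X -> K^o}) : X -> K^o :=
  fun x => c *: phi x.

Lemma scale_functional_linear c phi : linear (scale_functional c phi).
Proof.
move=> a u v; rewrite /scale_functional linearP scalerDr !scalerA.
by rewrite [c * a]mulrC.
Qed.
HB.instance Definition _ c phi :=
  GRing.isLinear.Build K X K^o _ (scale_functional c phi) (scale_functional_linear c phi).

Lemma functional_bounded (phi : {linear X -> K^o}) : continuous phi ->
  exists2 M : R, 0 <= M & forall x, sabs (phi x) <= M * rnorm x.
Proof.
move=> cphi; have [M M0 h] := linear_continuous_bound (linearP phi) cphi.
by exists M.
Qed.

Lemma scale_functional_continuous c (phi : {linear X -> K^o}) : continuous phi -> continuous (scale_functional c phi).
Proof.
move=> /functional_bounded[M M0 h].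
apply: (@bounded_continuous _ _ _ _ _ (sabs c * M)) => u v.
rewrite -scalerBr -linearB rnormZ -mulrA ler_wpM2l ?sabs_ge0 //.
exact: h.
Qed.

(** Weak integrals are unique because of this. *)
Lemma separating_functionals (x y : X) :
  (forall phi : {linear X -> K^o}, continuous phi -> Re (phi x) = Re (phi y)) -> x = y.
Proof.
move=> h; apply/eqP; rewrite -subr_eq0; apply/eqP; apply: rnorm_eq0.
have [phi [cphi _ <-]] := hahn_banach (x - y).
by rewrite linearB Re_sub h // subrr.
Qed.
Lemma hahn_banach_abs (y : X) : exists phi : {linear X -> K^o},
  [/\ continuous phi, forall x, `|Re (phi x)| <= rnorm x & Re (phi y) = rnorm y].
Proof.
have [phi [cphi h hy]] := hahn_banach y; exists phi; split => // x.
by rewrite ler_norml h andbT lerNl -Re_opp -linearN -(rnormN x) h.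
Qed.

End HahnBanach.

(** * Haar integration of compactly supported functions *)

Section CrossedProduct.
Variables (R : realType) (k : scalar_kind) (G : topologicalGroupType).
Local Notation K := (scalar_field R k).
Local Notation Re := (@scalar_Re R k).
Local Notation Im := (@scalar_Im R k).
Local Notation rc := (@real_scalar R k).
Local Notation nI := (@negI R k).
Local Notation Cc := (@Cc R k G).
Hypothesis G_hausdorff : hausdorff_space G.
Hypothesis G_lc : locally_compact [set: G].
Variable mu : {measure set (borel G) -> \bar R}.
Hypothesis mu_haar : left_haar_measure mu.
Implicit Types (r s : G) (C : set G).

Lemma continuous_mull r : continuous (fun s : G => r * s)%g.
Proof.
move=> s; apply: (@continuous_comp _ _ _ (fun t => (r, t)) (fun p : G * G => (p.1 * p.2)%g)).
  by apply: cvg_pair => /=; [exact: cvg_cst | exact: cvg_id].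
exact: mulg_continuous.
Qed.

Lemma image_mull r C : [set (r * s)%g | s in C] = [set s | C (r^-1 * s)%g].
Proof.
apply/seteqP; split=> [_ [s Cs <-]|s Cs] /=; first by rewrite mulKg.
by exists (r^-1 * s)%g; rewrite ?mulVKg.
Qed.

Lemma compact_mull r C : compact C -> compact [set s | C (r^-1 * s)%g].
Proof.
move=> cC; rewrite -image_mull; apply: continuous_compact => //.
by apply: continuous_subspaceT; exact: continuous_mull.
Qed.

Lemma open_mull r (V : set G) : open V -> open [set s | V (r * s)%g].
Proof. by move=> oV; apply: (@open_comp _ _ (fun s => r * s)%g V) => // s _; exact: continuous_mull. Qed.

Lemma compact_finite_cover (C : set G) (P : G -> set G) : compact C ->
  (forall r, C r -> nbhs r (P r)) ->
  exists l : seq G, forall s, C s -> exists r, [/\ r \in l, C r & (interior (P r)) s].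
Proof.
move=> cC CP; move: (cC); rewrite compact_cover => /(_ G C (fun r => interior (P r))).
case=> [r _|s Cs|D' DC CD]; first exact: open_interior.
  by exists s => //; exact: CP.
exists (finmap.enum_fset D') => s Cs; have [r rD' Prs] := CD s Cs; exists r; split=> //; exact/set_mem/DC.
Qed.

Lemma exists_compact_nbhs (x : G) : exists C, [/\ nbhs x C, compact C & closed C].
Proof.
have [U] := (@G_lc x I); rewrite withinET => Ux [cU clU].
by exists U.
Qed.

(** The compact set is an argument, so that functions with different supports can
    be compared on a common one. *)
Definition cont_supp C (f : G -> R) := continuous f /\ forall s, ~ C s -> f s = 0.
Definition haar_int (f : G -> R) : R := (\int[mu]_s (f : borel G -> R) s)%R.
Definition haar_size C : R := fine (mu C).

Lemma open_borel (V : set G) : open V -> measurable (V : set (borel G)).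
Proof. exact: sub_sigma_algebra. Qed.

Lemma closed_borel (V : set G) : closed V -> measurable (V : set (borel G)).
Proof.
by move=> cV; rewrite -(setCK V); apply: measurableC; apply: open_borel; exact: closed_openC.
Qed.

Lemma compact_borel C : compact C -> measurable (C : set (borel G)).
Proof. by move=> cC; apply: closed_borel; exact: compact_closed. Qed.

Lemma compact_finite C : compact C -> (mu C < +oo)%E.
Proof. by case: mu_haar => _ _ h _ _; exact: h. Qed.

Lemma continuous_borel (f : G -> R) : continuous f -> measurable_fun setT (f : borel G -> R).
Proof.
move=> cf; apply: (measurability _ (RGenOpens.measurableE R)) => //.
move=> _ [_ [a [b ->] <-]]; rewrite setTI; apply: open_borel.
by apply: open_comp => // s _; exact: cf.
Qed.

Lemma cont_supp_bounded C (f : G -> R) : compact C -> cont_supp C f ->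
  exists2 M, 0 <= M & forall s, `|f s| <= M.
Proof.
move=> cC [cf f0].
have : compact (f @` C).
  by apply: continuous_compact => //; exact: continuous_subspaceT.
move/compact_bounded => [M [_ /(_ (`|M| + 1))]] h.
exists (`|M| + 1); first by rewrite addr_ge0.
move=> s; have [Cs|nCs] := pselect (C s); last by rewrite f0 // normr0 addr_ge0.
by apply: h; [rewrite (le_lt_trans (ler_norm _)) // ltrDl | exists s].
Qed.

Lemma cont_supp_integrable C (f : G -> R) : compact C -> cont_supp C f ->
  mu.-integrable setT (EFin \o (f : borel G -> R)).
Proof.
move=> cC Cf; have [cf f0] := Cf.
have -> : EFin \o (f : borel G -> R) = (EFin \o (f : borel G -> R)) \_ (C : set (borel G)).
  apply/funext => s; rewrite /patch; case: ifPn => //.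
  by rewrite notin_setE => /f0 /= ->.
apply: (iffLR (integrable_mkcond _ (compact_borel cC))).
apply: measurable_bounded_integrable.
- exact: (compact_borel cC).
- exact: (compact_finite cC).
- by apply: measurable_funTS; exact: continuous_borel.
- have [M M0 fM] := cont_supp_bounded cC Cf.
  exists M; split; first by rewrite num_real.
  by move=> x Mx s Cs /=; apply: le_trans (fM s) (ltW Mx).
Qed.

Lemma integrable_compact C (f : G -> R) (B : set (borel G)) : compact C -> cont_supp C f ->
  measurable B -> mu.-integrable B (EFin \o (f : borel G -> R)).
Proof.
move=> cC Cf mB; apply: (@integrableS _ _ _ _ setT) => //.
exact: cont_supp_integrable cC Cf.
Qed.

Lemma haar_int_restr C (f : G -> R) : cont_supp C f ->
  haar_int f = \int[mu]_(s in (C : set (borel G))) (f : borel G -> R) s.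
Proof.
move=> [_ f0]; rewrite Rintegral_mkcond; congr fine; apply: eq_integral => s _.
rewrite /patch; case: ifPn => //.
by rewrite notin_setE => /f0 /= ->.
Qed.

Lemma haar_intD C (f g : G -> R) : compact C -> cont_supp C f -> cont_supp C g ->
  haar_int (fun s => f s + g s) = haar_int f + haar_int g.
Proof. by move=> cC Cf Cg; apply: RintegralD => //; exact: cont_supp_integrable cC _. Qed.

Lemma haar_intZ C (f : G -> R) a : compact C -> cont_supp C f ->
  haar_int (fun s => a * f s) = a * haar_int f.
Proof. by move=> cC Cf; apply: RintegralZl => //; exact: cont_supp_integrable cC _. Qed.

Lemma cont_supp0 C : cont_supp C (fun=> 0).
Proof. by split => // s; exact: cvg_cst. Qed.

Lemma cont_suppD C (f g : G -> R) : cont_supp C f -> cont_supp C g -> cont_supp C (fun s => f s + g s).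
Proof.
move=> [cf f0] [cg g0]; split=> [s|s Cs]; last by rewrite f0 // g0 // addr0.
by apply: cvgD; [exact: cf | exact: cg].
Qed.

Lemma cont_suppM C (f g : G -> R) : cont_supp C f -> continuous g -> cont_supp C (fun s => g s * f s).
Proof.
move=> [cf f0] cg; split=> [s|s Cs]; last by rewrite f0 // mulr0.
by apply: cvgM; [exact: cg | exact: cf].
Qed.

Lemma cont_suppZ C (f : G -> R) a : cont_supp C f -> cont_supp C (fun s => a * f s).
Proof. by move=> Cf; apply: cont_suppM => // s; exact: cvg_cst. Qed.

Lemma cont_suppB C (f g : G -> R) : cont_supp C f -> cont_supp C g -> cont_supp C (fun s => f s - g s).
Proof.
move=> Cf Cg; under eq_fun do rewrite -mulN1r.
by apply: cont_suppD => //; exact: cont_suppZ.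
Qed.

Lemma cont_supp_abs C (f : G -> R) : cont_supp C f -> cont_supp C (fun s => `|f s|).
Proof.
move=> [cf f0]; split=> [s|s Cs]; last by rewrite f0 // normr0.
by apply: (@continuous_comp _ _ _ f Num.norm); [exact: cf | exact: norm_continuous].
Qed.

Lemma haar_intB C (f g : G -> R) : compact C -> cont_supp C f -> cont_supp C g ->
  haar_int (fun s => f s - g s) = haar_int f - haar_int g.
Proof. by move=> cC Cf Cg; apply: RintegralB => //; exact: cont_supp_integrable cC _. Qed.

Lemma le_haar_int C (f g : G -> R) : compact C -> cont_supp C f -> cont_supp C g ->
  (forall s, f s <= g s) -> haar_int f <= haar_int g.
Proof. by move=> cC Cf Cg fg; apply: le_Rintegral => //; exact: cont_supp_integrable cC _. Qed.

Lemma haar_int_ge0 (f : G -> R) : (forall s, 0 <= f s) -> 0 <= haar_int f.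
Proof. by move=> f0; exact: Rintegral_ge0. Qed.

Lemma haar_size_ge0 C : 0 <= haar_size C.
Proof. exact: fine_ge0. Qed.

Lemma integrable_cst_compact C (B : set (borel G)) (a : R) : compact C -> measurable B ->
  B `<=` C -> mu.-integrable B (EFin \o (fun=> a)).
Proof.
move=> cC mB BC; apply: measurable_bounded_integrable => //.
  apply: le_lt_trans (compact_finite cC); apply: le_measure BC; rewrite inE //.
  exact: (compact_borel cC).
exists `|a|; split; first by rewrite num_real.
by move=> x ax s Bs /=; exact: ltW.
Qed.

Lemma haar_int_bound C (f : G -> R) M : compact C -> cont_supp C f ->
  (forall s, C s -> `|f s| <= M) -> `|haar_int f| <= M * haar_size C.
Proof.
move=> cC Cf fM; have mC := compact_borel cC.
rewrite (haar_int_restr Cf) -Rintegral_cst //.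
apply: le_trans (le_normr_Rintegral mC (integrable_compact cC Cf mC)) _.
apply: le_Rintegral => //.
  by apply: (integrable_compact cC) => //; exact: cont_supp_abs.
exact: integrable_cst_compact cC mC _.
Qed.

Section Quadrature.
Variable C : set G.
Hypothesis cC : compact C.

(** Induction on a finite open cover: the part of B inside the first piece V is
    charged to the point r attached to V, and the rest of the cover handles the
    remainder. *)
Let quadrature_list (l : seq (set G * G)) (B : set (borel G)) :
  (forall p, p \in l -> open p.1) -> measurable B -> B `<=` C ->
  (forall s, B s -> exists2 p, p \in l & p.1 s) ->
  exists w : seq (R * G), forall (f : G -> R) (e : R), cont_supp C f ->
    (forall p s, p \in l -> p.1 s -> C s -> `|f s - f p.2| <= e) ->
    `|\int[mu]_(s in B) (f : borel G -> R) s - \sum_(p <- w) p.1 * f p.2|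
       <= e * fine (mu B).
Proof.
elim: l B => [|[V r] l IH] B lo mB BC Bl.
  have -> : B = set0 by apply/seteqP; split=> s // /Bl[].
  by exists [::] => f e _ _; rewrite Rintegral_set0 big_nil subrr normr0 measure0 mulr0.
have mV : measurable (V : set (borel G)).
  by apply: open_borel; apply: (lo (V, r)); rewrite mem_head.
have mBV : measurable (B `&` V) by exact: measurableI.
have mBD : measurable (B `\` V) by exact: measurableD.
have [||||w wP] := IH (B `\` V) => //.
- by move=> p pl; apply: lo; rewrite inE pl orbT.
- by move=> s [Bs _]; exact: BC.
- move=> s [/Bl[p]]; rewrite inE => /orP[/eqP-> //|pl ps _]; by exists p.
have BE : B = (B `&` V) `|` (B `\` V) by rewrite setUIDK.
exists ((fine (mu (B `&` V)), r) :: w) => f e Cf fe.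
have h : `|\int[mu]_(s in B `\` V) (f : borel G -> R) s - \sum_(p <- w) p.1 * f p.2|
    <= e * fine (mu (B `\` V)).
  by apply: wP => // p s pl; apply: fe; rewrite inE pl orbT.
have dj : [disjoint B `&` V & B `\` V].
  by apply/disj_setPS => s [[_ Vs] [_ /(_ Vs)]].
have fin_sub (D : set (borel G)) : measurable D -> D `<=` B -> mu D \is a fin_num.
  move=> mD DB; rewrite ge0_fin_numE //; apply: le_lt_trans (compact_finite cC).
  apply: le_measure; rewrite ?inE //; first exact: (compact_borel cC).
  by move=> s /DB/BC.
have muE : fine (mu B) = fine (mu (B `&` V)) + fine (mu (B `\` V)).
  rewrite -fineD ?fin_sub //; [|by move=> ? []..].
  rewrite -measureU // -?BE //.
  by apply/seteqP; split=> s // [[_ Vs] [_ /(_ Vs)]].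
have intB (D : set (borel G)) := integrable_compact cC Cf (B := D).
rewrite big_cons /=.
have -> : \int[mu]_(s in B) (f : borel G -> R) s =
  \int[mu]_(s in B `&` V) (f : borel G -> R) s +
  \int[mu]_(s in B `\` V) (f : borel G -> R) s.
  by rewrite -Rintegral_setU // -?BE //; exact: intB.
have h1 : `|\int[mu]_(s in B `&` V) (f : borel G -> R) s - fine (mu (B `&` V)) * f r|
   <= e * fine (mu (B `&` V)).
  have ic (a : R) : mu.-integrable (B `&` V) (EFin \o (fun=> a)).
    apply: (integrable_cst_compact a cC mBV) => s [Bs _]; exact: BC.
  rewrite mulrC -(Rintegral_cst mu mBV) -RintegralB //; do ?[exact: intB|exact: ic].
  have i1 : mu.-integrable (B `&` V) (EFin \o (fun s : borel G => f s - f r)).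
    have -> : EFin \o (fun s : borel G => f s - f r) =
      ((EFin \o (f : borel G -> R)) \- (EFin \o (fun=> f r)))%E by apply/funext.
    by apply: integrableB => //; do ?[exact: intB|exact: ic].
  apply: le_trans (le_normr_Rintegral mBV i1) _.
  rewrite -Rintegral_cst //; apply: le_Rintegral => //.
    have -> : EFin \o (fun s : borel G => `|f s - f r|) =
      abse \o (EFin \o (fun s : borel G => f s - f r)) by apply/funext.
    exact: integrable_abse.
  by move=> s [Bs Vs]; apply: (fe (V, r)) => //; [rewrite mem_head|exact: BC].
rewrite muE mulrDr opprD addrACA.
exact: le_trans (ler_normD _ _) (lerD h1 h).
Qed.

(** The nodes and weights depend on the neighbourhoods P r only, not on f. This
    uniformity makes vector-valued sums converge, and it takes the place of a
    product measure in the exchange of integrals. *)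
Lemma quadrature (P : G -> set G) : (forall r, C r -> nbhs r (P r)) ->
  exists w : seq (R * G), forall (f : G -> R) (e : R), cont_supp C f ->
    (forall r s, C r -> C s -> P r s -> `|f s - f r| <= e) ->
    `|haar_int f - \sum_(p <- w) p.1 * f p.2| <= e * haar_size C.
Proof.
move=> CP.
have [l lP] := compact_finite_cover cC CP.
have [||||w wP] := @quadrature_list
   [seq (interior (P r), r) | r <- l & `[< C r >]] C.
- by move=> p /mapP[r _ ->]; exact: open_interior.
- exact: (compact_borel cC).
- by [].
- move=> s /lP[r [rl Cr Ps]]; exists (interior (P r), r) => //.
  by apply/mapP; exists r => //; rewrite mem_filter rl andbT; exact/asboolP.
- exists w => f e Cf fe; rewrite (haar_int_restr Cf); apply: wP => // p s.
  move=> /mapP[r]; rewrite mem_filter => /andP[/asboolP Cr _] -> /= /interior_subset Ps Cs.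
  exact: fe.
Qed.
End Quadrature.

(** By left invariance, mu is its own image measure under left translation. *)
Lemma haar_int_translate C (f : G -> R) r : compact C -> cont_supp C f ->
  haar_int (fun s => f (r * s)%g) = haar_int f.
Proof.
move=> cC Cf; rewrite /haar_int /Rintegral; congr fine.
pose phi (s : borel G) : borel G := (r * s)%g.
have mphi : measurable_fun setT phi.
  apply: (measurability _ (erefl (@measurable _ (borel G)))) => _ [B oB <-].
  rewrite setTI; apply: open_borel.
  exact: open_mull.
have Cf' : cont_supp [set s | C (r^-1^-1 * s)%g] (fun s => f (r * s)%g).
  split=> [s|s /= nC].
    by apply: (@continuous_comp _ _ _ (fun s => (r * s)%g) f);
      [exact: continuous_mull | exact: Cf.1].
  by apply: Cf.2; rewrite invgK in nC.
transitivity (\int[pushforward mu phi]_s ((f : borel G -> R) s)%:E)%E.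
  rewrite (integral_pushforward mphi) //.
    by apply/measurable_EFinP; apply: continuous_borel; exact: Cf.1.
  rewrite preimage_setT.
  have := (cont_supp_integrable (compact_mull (r:=r^-1%g) cC) Cf'). exact.
apply: eq_measure_integral => B mB _; rewrite /pushforward.
have [_ inv _ _ _] := mu_haar.
rewrite -[RHS](inv r^-1%g) //; congr (mu _).
by rewrite image_mull invgK.
Qed.

(** If V were null, finitely many translates of V would cover any compact set, so
    all compact sets would be null, and G too by inner regularity. *)
Lemma haar_open_gt0 (V : set G) x : open V -> V x -> (0 < mu V)%E.
Proof.
move=> oV Vx; rewrite lt_neqAle measure_ge0 andbT; apply/eqP => V0.
have [muT inv _ _ inner] := mu_haar.
have trans0 r : mu [set s | V (r^-1 * s)%g] = 0%E.
  by rewrite -image_mull inv -?V0 //; exact: open_borel.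
have nul C : compact C -> mu C = 0%E.
  move=> cC.
  have [|l lP] := @compact_finite_cover C (fun r => [set s | V ((r * x^-1)^-1 * s)%g]) cC.
    move=> r Cr; apply: open_nbhs_nbhs; split; first exact: open_mull.
    by rewrite /= invgM invgK -mulgA mulVg mulg1.
  have : forall B : set G, measurable (B : set (borel G)) ->
     (forall s, B s -> exists2 r, r \in l & V ((r * x^-1)^-1 * s)%g) -> mu B = 0%E.
    elim: l {lP} => [|r l IH] B mB Bl.
      have -> : B = set0 by apply/seteqP; split=> s // /Bl[].
      exact: measure0.
    pose W := [set s | V ((r * x^-1)^-1 * s)%g].
    have mW : measurable (W : set (borel G)) by apply: open_borel; exact: open_mull.
    have BD : mu (B `\` W) = 0%E.
      apply: IH; first exact: measurableD.
      by move=> s [/Bl[t]]; rewrite inE => /orP[/eqP->//|tl Vt _]; exists t.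
    apply/eqP; rewrite eq_le measure_ge0 andbT.
    rewrite -(setUIDK B W).
    apply: le_trans (measureU2 mu (measurableI _ _ mB mW) (measurableD mB mW)) _.
    rewrite [X in (_ + X)%E]BD adde0 -(trans0 (r * x^-1)%g).
    apply: le_measure; rewrite ?inE //; exact: measurableI.
  apply; first exact: (compact_borel cC).
  by move=> s /lP[r [rl _ /interior_subset]]; exists r.
apply: muT; rewrite inner; last exact: openT.
apply/eqP; rewrite eq_le; apply/andP; split.
  by apply: ge_ereal_sup => _ [C [cC _] <-]; rewrite nul.
by apply: ereal_sup_ubound; exists set0; rewrite ?measure0 //; split; first exact: compact0.
Qed.

Lemma haar_int_gt0 C (f : G -> R) x : compact C -> cont_supp C f -> (forall s, 0 <= f s) ->
  0 < f x -> 0 < haar_int f.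
Proof.
move=> cC Cf f0 fx.
pose V := f @^-1` [set y | f x / 2 < y].
have oV : open V by apply: open_comp; [move=> s _; exact: Cf.1 | exact: open_gt].
have mV := open_borel oV.
have f20 : 0 < f x / 2 by rewrite divr_gt0.
have Vx : V x by rewrite /V /=; lra.
have VC : V `<=` C.
  by move=> s Vs; apply: contrapT => /Cf.2 fs; move: Vs; rewrite /V /= fs; lra.
have muV : 0 < fine (mu V).
  apply: fine_gt0; rewrite (haar_open_gt0 oV Vx) /=.
  apply: le_lt_trans (compact_finite cC).
  by apply: le_measure; rewrite ?inE //; exact: (compact_borel cC).
apply: (@lt_le_trans _ _ (f x / 2 * fine (mu V))); first exact: mulr_gt0.
rewrite -Rintegral_cst //.
apply: (@le_trans _ _ (\int[mu]_(s in (V : set (borel G))) (f : borel G -> R) s)).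
  apply: le_Rintegral => //; last by move=> s /ltW.
    exact: integrable_cst_compact cC mV _.
  exact: integrable_compact cC Cf mV.
rewrite Rintegral_mkcond; apply: le_Rintegral => //.
- rewrite -restrict_EFin; apply: (iffLR (integrable_mkcond _ mV)).
  exact: integrable_compact cC Cf mV.
- exact: cont_supp_integrable cC Cf.
- by move=> s _; rewrite /patch; case: ifPn.
Qed.

(** Locally compact Hausdorff spaces are completely regular; the separating
    function has integral > 0 because nonempty open sets have measure > 0. *)
Lemma exists_bump (x : G) (V : set G) : nbhs x V ->
  exists C u, [/\ compact C, C `<=` V, cont_supp C u, (forall s, 0 <= u s) & haar_int u = 1].
Proof.
move=> Vx; have [C0 [C0x cC0 clC0]] := exists_compact_nbhs x.
have reg := @locally_compact_completely_regular G R G_lc G_hausdorff.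
have [W Wx WV] : exists2 W : set G, nbhs x W & closure W `<=` V `&` C0.
  have := @completely_regular_regular R G reg x (V `&` C0) (filterI Vx C0x).
  by case=> W Wx WV; exists W.
have clD : closed (~` interior W) by apply: open_closedC; exact: open_interior.
have /uniform_separatorP-/(_ R)[f [cf f01 fx0 fW1]] := reg x _ clD (fun h => h Wx).
pose C := closure W.
have cC : compact C.
  by apply: (subclosed_compact _ cC0); [exact: closed_closure | move=> s /WV[]].
pose u s := 1 - f s.
have Cu : cont_supp C u.
  split=> [s|s nCs]; first by apply: cvgB; [exact: cvg_cst|exact: cf].
  rewrite /u; suff -> : f s = 1 by rewrite subrr.
  by apply: fW1; exists s => // /interior_subset/subset_closure.
have u0 s : 0 <= u s.
  have : range f (f s) by exists s.
  by move/f01; rewrite /= in_itv /= subr_ge0 => /andP[].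
have ux : 0 < u x.
  by rewrite /u (_ : f x = 0) ?subr0 ?ltr01 //; apply: fx0; exists x.
have I0 := haar_int_gt0 cC Cu u0 ux.
exists C, (fun s => (haar_int u)^-1 * u s); split => //.
- by move=> s /WV[].
- exact: cont_suppZ.
- by move=> s; rewrite mulr_ge0 // invr_ge0 ltW.
- by rewrite (haar_intZ _ cC Cu) mulVf // gt_eqF.
Qed.

(** * Weak integrals in Banach spaces *)

Definition vcont_supp (X : normedModType K) (C : set G) (F : G -> X) :=
  continuous F /\ forall s, ~ C s -> F s = 0.

Lemma cont_supp_functional (X : normedModType K) C (F : G -> X) (phi : {linear X -> K^o}) :
  vcont_supp C F -> continuous phi -> cont_supp C (fun s => Re (phi (F s))).
Proof.
move=> [cF F0] /functional_bounded[M M0 h]; split=> [s|s Cs]; last by rewrite F0 // linear0 Re_zero.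
apply/cvgrPdist_lt => e e0.
have M1 : 0 < M + 1 by lra.
have e10 : 0 < e / (M + 1) by rewrite divr_gt0.
have := iffLR (cvg_rnormP F s) (cF s) _ e10; apply: filterS => t.
rewrite ltr_pdivlMr // => hh; rewrite -Re_sub -linearB.
apply: le_lt_trans (abs_Re_le _) _.
have := h (F s - F t); have := rnorm_ge0 (F s - F t); nra.
Qed.

(** Real parts are enough: the imaginary part of phi is the real part of
    negI *: phi (weak_integralP). *)
Definition weak_integral (X : normedModType K) (F : G -> X) (y : X) :=
  forall phi : {linear X -> K^o}, continuous phi ->
    Re (phi y) = haar_int (fun s => Re (phi (F s))).

Lemma Re_scalar_integral (h : G -> K) :
  Re (scalar_integral mu h) = haar_int (fun s => Re (h s)).
Proof. exact: Re_mk. Qed.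

Lemma Im_scalar_integral (h : G -> K) :
  Im (scalar_integral mu h) = haar_int (fun s => Im (h s)).
Proof.
apply: Im_mk => kR.
rewrite /Rintegral (eq_integral (cst 0)); first by rewrite integral0.
move=> s _; rewrite /cst; congr (_%:E); move: (h s); rewrite kR.
by [].
Qed.

Lemma weak_integralP (X : normedModType K) (F : G -> X) (y : X) :
  weak_integral F y <-> forall phi : {linear X -> K^o}, continuous phi ->
    phi y = scalar_integral mu (fun s => phi (F s)).
Proof.
split=> h phi cphi; last by rewrite h // Re_scalar_integral.
apply: scalar_ext; first by rewrite h // Re_scalar_integral.
rewrite Im_scalar_integral.
have := h (scale_functional nI phi) (scale_functional_continuous (c := nI) cphi).
rewrite -[Re _]Im_Re_negI => ->; congr haar_int; apply/funext => s.
by rewrite Im_Re_negI.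
Qed.

Lemma vector_integral_unique (X : normedModType K) (F : G -> X) (y : X) :
  weak_integral F y -> vector_integral mu F = y.
Proof.
move=> Fy; rewrite /vector_integral; case: xgetP => [z _ /weak_integralP Fz|].
  by apply: separating_functionals => phi cphi; rewrite Fz // Fy.
by move=> /(_ y) []; exact/weak_integralP.
Qed.

Section Existence.
Variables (X : completeNormedModType K) (C : set G) (F : G -> X).
Hypotheses (cC : compact C) (CF : vcont_supp C F).

Let combination (w : seq (R * G)) : X := \sum_(p <- w) rc p.1 *: F p.2.

(** Candidates at precision e for the integral of F: finite combinations of values
    of F that compute the integral of every functional of norm at most M up to
    the error M * e. *)
Let approx (e : R) : set X := [set x | exists2 w, x = combination w &
  forall (phi : {linear X -> K^o}) (M : R), continuous phi -> 0 <= M ->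
    (forall z, `|Re (phi z)| <= M * rnorm z) ->
    `|haar_int (fun s => Re (phi (F s))) - Re (phi x)| <= M * e].

Let approx_neq0 e : 0 < e -> approx e !=set0.
Proof.
move=> e0; have m0 := haar_size_ge0 C.
have d0 : 0 < e / (haar_size C + 1) by rewrite divr_gt0 //; lra.
pose d := e / (haar_size C + 1).
have [|w wP] := @quadrature C cC (fun r => [set s | rnorm (F r - F s) < d]).
  by move=> r _; exact: (iffLR (cvg_rnormP F r) (CF.1 r) _ d0).
exists (combination w), w => // phi M cphi M0 phiM.
have -> : Re (phi (combination w)) = \sum_(p <- w) p.1 * Re (phi (F p.2)).
  rewrite /combination linear_sum /=.
  elim: (w) => [|p w' IH]; first by rewrite !big_nil Re_zero.
  by rewrite !big_cons Re_add IH linearZ /= Re_rcM.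
apply: le_trans (wP _ (M * d) (cont_supp_functional CF cphi) _) _.
  move=> r s _ _ /= rs; rewrite -Re_sub -linearB; apply: le_trans (phiM _) _.
  by rewrite rnormBC ler_wpM2l // ltW.
rewrite -mulrA ler_wpM2l // /d mulrAC ler_pdivrMr; last by lra.
by rewrite ler_pM2l //; lra.
Qed.

(** Two candidates are compared by a functional that norms their difference; it
    integrates F, so its values at the candidates differ by at most the sum of
    the precisions. *)
Lemma weak_integral_exists : exists y, weak_integral F y /\
  forall e, 0 < e -> exists w : seq (R * G), rnorm (\sum_(p <- w) rc p.1 *: F p.2 - y) <= e.
Proof.
have [|l lP] := complete_approx approx_neq0.
  move=> e e' x y e0 e'0 [w _ wx] [w' _ wy].
  have [phi [cphi h <-]] := hahn_banach_abs (x - y).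
  have h1 z : `|Re (phi z)| <= 1 * rnorm z by rewrite mul1r.
  have := wx phi 1 cphi ler01 h1; have := wy phi 1 cphi ler01 h1.
  rewrite !mul1r linearB Re_sub !ler_norml => /andP[? ?] /andP[? ?].
  by lra.
exists l; split; last first.
  move=> e e0; have [x Ax] := approx_neq0 e0.
  by have [w xE _] := Ax; exists w; rewrite -/(combination w) -xE; exact: lP Ax.
move=> phi cphi; have [M M0 h] := functional_bounded cphi.
have h1 z : `|Re (phi z)| <= M * rnorm z.
  exact: le_trans (abs_Re_le _) (h z).
apply/eqP; rewrite -subr_eq0 -normr_le0; apply/ler_addgt0Pr => e e0; rewrite add0r.
have M1 : 0 < 2 * (M + 1) by lra.
have d0 : 0 < e / (2 * (M + 1)) by rewrite divr_gt0.
have [x Ax] := approx_neq0 d0; have := lP _ _ d0 Ax.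
have [w _ /(_ phi M cphi M0 h1)] := Ax.
have := h1 (x - l); rewrite linearB Re_sub.
set d := e / _ in d0 *.
have -> : e = d * (2 * (M + 1)) by rewrite /d mulfVK // gt_eqF.
rewrite !ler_norml => /andP[a1 a2] /andP[a3 a4] a5.
have : M * rnorm (x - l) <= M * d by rewrite ler_wpM2l.
have Md : 0 <= M * d by rewrite mulr_ge0 // ltW.
by move=> a6; apply/andP; split; nra.
Qed.

Lemma vector_integralP : weak_integral F (vector_integral mu F).
Proof.
have [y [Fy _]] := weak_integral_exists.
by rewrite (vector_integral_unique Fy).
Qed.

Lemma vector_integral_approx e : 0 < e ->
  exists w : seq (R * G), rnorm (\sum_(p <- w) rc p.1 *: F p.2 - vector_integral mu F) <= e.
Proof.
have [y [Fy yP]] := weak_integral_exists.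
by rewrite (vector_integral_unique Fy); exact: yP.
Qed.

(** A norming functional reduces the bound to the monotony of the real integral. *)
Lemma rnorm_vector_integral g : cont_supp C g -> (forall s, rnorm (F s) <= g s) ->
  rnorm (vector_integral mu F) <= haar_int g.
Proof.
move=> Cg Fg; have [phi [cphi h <-]] := hahn_banach_abs (vector_integral mu F).
rewrite vector_integralP //; apply: (le_haar_int cC) => //.
  exact: cont_supp_functional.
move=> s; apply: le_trans (Fg s); apply: le_trans (h _); exact: ler_norm.
Qed.

Lemma vector_integral_subspace (Y : set X) : closed Y -> linear_subspace Y ->
  (forall s, Y (F s)) -> Y (vector_integral mu F).
Proof.
move=> cY [Y0 YD] YF; apply: closed_rnorm => // e e0.
have e20 : 0 < e / 2 by rewrite divr_gt0.
have [w we] := vector_integral_approx e20.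
exists (\sum_(p <- w) rc p.1 *: F p.2); last by rewrite rnormBC; lra.
by elim: w {we} => [|p w IH]; [rewrite big_nil|rewrite big_cons; exact: YD].
Qed.
End Existence.

Section Operations.
Variables (X Y : completeNormedModType K) (C : set G).
Hypotheses (cC : compact C).

Lemma vector_integralD (F F' : G -> X) c : vcont_supp C F -> vcont_supp C F' ->
  vector_integral mu (fun s => c *: F s + F' s) =
  c *: vector_integral mu F + vector_integral mu F'.
Proof.
move=> CF CF'; apply: vector_integral_unique => phi cphi.
have cphi' := scale_functional_continuous (c := c) cphi.
rewrite linearP Re_add (vector_integralP cC CF' cphi).
have -> : Re (c *: phi (vector_integral mu F)) = haar_int (fun s => Re (c *: phi (F s))).
  exact: (vector_integralP cC CF cphi').
rewrite -(haar_intD cC).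
- by congr haar_int; apply/funext => s; rewrite linearP Re_add.
- exact: (cont_supp_functional CF cphi').
- exact: (cont_supp_functional CF' cphi).
Qed.

Lemma vector_integral_bounded (F : G -> X) (T : X -> Y) : vcont_supp C F ->
  bounded_operator T -> T (vector_integral mu F) = vector_integral mu (T \o F).
Proof.
move=> CF /bounded_operatorP[lT [M M0 TM]].
symmetry; apply: vector_integral_unique => phi cphi.
pose f : X -> K^o := phi \o T.
have lf : linear f by move=> c u v; rewrite /f /= lT linearP.
pose psi : {linear X -> K^o} := HB.pack f (GRing.isLinear.Build _ _ _ _ f lf).
have cpsi : continuous psi.
  have [N N0 phiN] := functional_bounded cphi.
  apply: (@bounded_continuous _ _ _ _ _ (N * M)) => u v.
  rewrite -linearB -mulrA /=; apply: le_trans (phiN _) _.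
  by rewrite ler_wpM2l.
exact: (vector_integralP cC CF cpsi).
Qed.

Lemma vector_integral_translate (F : G -> X) r : vcont_supp C F ->
  vector_integral mu (fun s => F (r * s)%g) = vector_integral mu F.
Proof.
move=> CF; apply: vector_integral_unique => phi cphi.
rewrite (vector_integralP cC CF cphi).
by rewrite (haar_int_translate r cC (cont_supp_functional CF cphi)).
Qed.
End Operations.

(** * Exchanging integrals *)

(** The tube lemma for a compact set of parameters. *)
Lemma uniform_near (h : G -> G -> R) (C : set G) r (e : R) :
  continuous (fun p : G * G => h p.1 p.2) -> compact C -> 0 < e ->
  \forall r' \near r, forall s, C s -> `|h r' s - h r s| < e.
Proof.
move=> ch cC e0.
apply: (iffLR (compact_near_coveringP C) cC G (nbhs r) (fun r' s => `|h r' s - h r s| < e)).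
move=> s Cs; have e20 : 0 < e / 2 by rewrite divr_gt0.
have /cvgrPdist_lt/(_ _ e20) := ch (r, s).
move=> [[A B] /= [Ar Bs] AB].
exists (B, A) => //= -[s' r'] /= [Bs' Ar'].
have h1 := AB (r', s') (conj Ar' Bs').
have h2 := AB (r, s') (conj (nbhs_singleton Ar) Bs').
move: h1 h2 => /=; rewrite !ltr_norml => /andP[? ?] /andP[? ?].
by apply/andP; split; lra.
Qed.

Lemma continuous_section (h : G -> G -> R) r :
  continuous (fun p : G * G => h p.1 p.2) -> continuous (h r).
Proof.
move=> ch s; apply: (@continuous_comp _ _ _ (fun t => (r, t)) (fun p : G * G => h p.1 p.2)).
  by apply: cvg_pair => /=; [exact: cvg_cst | exact: cvg_id].
exact: ch.
Qed.

Lemma continuous_swap (h : G -> G -> R) :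
  continuous (fun p : G * G => h p.1 p.2) -> continuous (fun p : G * G => h p.2 p.1).
Proof.
move=> ch p; apply: (@continuous_comp _ _ _ (fun q => (q.2, q.1)) (fun q : G * G => h q.1 q.2)).
  by apply: cvg_pair => /=; [exact: cvg_snd | exact: cvg_fst].
exact: ch.
Qed.

Lemma continuous_haar_int (h : G -> G -> R) (C : set G) :
  continuous (fun p : G * G => h p.1 p.2) -> compact C ->
  (forall r s, ~ C s -> h r s = 0) -> continuous (fun r => haar_int (h r)).
Proof.
move=> ch cC h0 r; apply/cvgrPdist_lt => e e0.
have m0 := haar_size_ge0 C.
have d0 : 0 < e / (haar_size C + 1) by rewrite divr_gt0 //; lra.
have Ch t : cont_supp C (h t) by split; [exact: continuous_section | exact: h0].
apply: filterS (uniform_near r ch cC d0) => r' hr.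
rewrite -(haar_intB cC (Ch r) (Ch r')).
apply: (@le_lt_trans _ _ (e / (haar_size C + 1) * haar_size C)).
  apply: (haar_int_bound cC); first exact: cont_suppB.
  by move=> s Cs; rewrite distrC ltW // hr.
by rewrite mulrAC ltr_pdivrMr; [rewrite ltr_pM2l //; lra | lra].
Qed.

(** Product measures are of no use for a group that is not second countable: the
    measure need not be sigma-finite, and continuous functions on G * G need not
    be measurable for the product of the Borel sigma-algebras. Instead a
    quadrature formula in r, accurate uniformly in s, computes both iterated
    integrals. *)
Lemma fubini (h : G -> G -> R) (C1 C2 : set G) :
  continuous (fun p : G * G => h p.1 p.2) -> compact C1 -> compact C2 ->
  (forall r s, ~ C1 r -> h r s = 0) -> (forall r s, ~ C2 s -> h r s = 0) ->
  haar_int (fun r => haar_int (h r)) = haar_int (fun s => haar_int (fun r => h r s)).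
Proof.
move=> ch cC1 cC2 h1 h2.
have Ch r : cont_supp C2 (h r) by split; [exact: continuous_section | exact: h2].
have Ch' s : cont_supp C1 (fun r => h r s).
  split; last by move=> r; exact: h1.
  exact: (@continuous_section (fun s r => h r s) s (continuous_swap ch)).
have haar_int_0 : haar_int (fun=> 0) = 0.
  by rewrite /haar_int Rintegral_cst // mul0r.
have CI1 : cont_supp C1 (fun r => haar_int (h r)).
  split; first exact: continuous_haar_int ch cC2 h2.
  by move=> r nr; rewrite (_ : h r = fun=> 0) //; apply/funext => s; exact: h1.
have CI2 : cont_supp C2 (fun s => haar_int (fun r => h r s)).
  split.
    apply: (@continuous_haar_int (fun s r => h r s) C1) => //; first exact: continuous_swap.
    by move=> s r; exact: h1.
  by move=> s ns; rewrite (_ : (fun r => h r s) = fun=> 0) //; apply/funext => r; exact: h2.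
have m1 := haar_size_ge0 C1; have m2 := haar_size_ge0 C2.
apply/eqP; rewrite -subr_eq0 -normr_le0; apply/ler_addgt0Pr => e e0; rewrite add0r.
(* the two errors below are at most d * haar_size C1 * haar_size C2 each *)
pose d := e / (2 * (haar_size C1 * haar_size C2 + 1)).
have M0 : 0 < 2 * (haar_size C1 * haar_size C2 + 1).
  by have := mulr_ge0 m1 m2; lra.
have d0 : 0 < d by rewrite divr_gt0.
have [|w wP] := @quadrature C1 cC1
  (fun r => [set r' | forall s, C2 s -> `|h r' s - h r s| < d]).
  by move=> r _; exact: uniform_near.
have q1 : `|haar_int (fun r => haar_int (h r)) - \sum_(p <- w) p.1 * haar_int (h p.2)|
    <= (d * haar_size C2) * haar_size C1.
  apply: wP => // r r' _ _ rr'.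
  rewrite -(haar_intB cC2) //.
  apply: (haar_int_bound cC2); first exact: cont_suppB.
  by move=> s C2s; apply/ltW/rr'.
have q2 s : `|haar_int (fun r => h r s) - \sum_(p <- w) p.1 * h p.2 s| <= d * haar_size C1.
  apply: wP => // r r' _ _ rr'.
  have [/rr'/ltW//|ns] := pselect (C2 s).
  by rewrite !h2 // subrr normr0 ltW.
have Cw v : cont_supp C2 (fun s => \sum_(p <- v) p.1 * h p.2 s) /\
  haar_int (fun s => \sum_(p <- v) p.1 * h p.2 s) = \sum_(p <- v) p.1 * haar_int (h p.2).
  elim: v => [|p v [IH1 IH2]].
    by under eq_fun do rewrite big_nil; rewrite big_nil; split=> //; exact: cont_supp0.
  under eq_fun do rewrite big_cons.
  have Cp : cont_supp C2 (fun s => p.1 * h p.2 s) by exact: cont_suppZ.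
  split; first exact: cont_suppD.
  by rewrite big_cons (haar_intD cC2) // IH2 (haar_intZ _ cC2).
have [Cw1 Cw2] := Cw w; rewrite -Cw2 in q1.
have {}q2 : `|haar_int (fun s => haar_int (fun r => h r s)) -
   haar_int (fun s => \sum_(p <- w) p.1 * h p.2 s)| <= d * haar_size C1 * haar_size C2.
  rewrite -(haar_intB cC2) //.
  by apply: (haar_int_bound cC2) => //; exact: cont_suppB.
have -> : e = d * (2 * (haar_size C1 * haar_size C2 + 1)).
  by rewrite /d mulfVK // gt_eqF.
move: q1 q2; rewrite !ler_norml => /andP[? ?] /andP[? ?].
by apply/andP; split; lra.
Qed.

(** * Compactly supported functions, translation and convolution *)

Implicit Types f g : G -> K.

Lemma CcP f : Cc f <-> exists2 C, compact C & vcont_supp C (f : G -> K^o).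
Proof.
split=> [[cf cC]|[C cC [cf f0]]].
  exists (closure [set s | f s != 0]) => //; split => // s ns.
  by apply/eqP; apply: contra_notT ns => fs; exact: subset_closure.
split=> //; apply: (subclosed_compact _ cC); first exact: closed_closure.
rewrite [X in _ `<=` X](closure_id C).1; last exact: compact_closed.
by apply: closureS => s /= fs; apply: contrapT => /f0 /eqP; rewrite (negbTE fs).
Qed.

Lemma vcont_supp_sub (X : normedModType K) C C' (F : G -> X) : C `<=` C' ->
  vcont_supp C F -> vcont_supp C' F.
Proof. by move=> CC [cf f0]; split=> // s Cs; apply: f0; apply: contra_not Cs; exact: CC. Qed.

Lemma vcont_suppD (X : normedModType K) C (F F' : G -> X) (c : K) :
  vcont_supp C F -> vcont_supp C F' -> vcont_supp C (fun s => c *: F s + F' s).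
Proof.
move=> [cF F0] [cF' F'0]; split=> [s|s Cs]; last by rewrite F0 // F'0 // scaler0 addr0.
by apply: cvgD; [apply: cvgZ; [exact: cvg_cst | exact: cF] | exact: cF'].
Qed.

Lemma compact_common (P Q : set G -> Prop) :
  (forall C C', C `<=` C' -> P C -> P C') -> (forall C C', C `<=` C' -> Q C -> Q C') ->
  (exists2 C, compact C & P C) -> (exists2 C, compact C & Q C) ->
  exists C, [/\ compact C, P C & Q C].
Proof.
move=> Pm Qm [C cC PC] [C' cC' QC']; exists (C `|` C'); split.
- exact: compactU.
- by apply: Pm PC; exact: subsetUl.
- by apply: Qm QC'; exact: subsetUr.
Qed.

Lemma Cc_common f g : Cc f -> Cc g ->
  exists C, [/\ compact C, vcont_supp C (f : G -> K^o) & vcont_supp C (g : G -> K^o)].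
Proof.
move=> /CcP Cf /CcP Cg; apply: compact_common => // C C' CC; exact: vcont_supp_sub.
Qed.

Lemma Cc_add (c : K) f g : Cc f -> Cc g -> Cc (fun s => c * f s + g s).
Proof.
move=> Cf Cg; have [C [cC Cf' Cg']] := Cc_common Cf Cg.
by apply/CcP; exists C => //; exact: (vcont_suppD c Cf' Cg').
Qed.

Lemma Cc_zero : Cc (fun=> 0).
Proof. by apply/CcP; exists set0; [exact: compact0|split=> // s; exact: cvg_cst]. Qed.

Lemma Cc_sub f g : Cc f -> Cc g -> Cc (fun s => f s - g s).
Proof.
move=> Cf Cg; rewrite (_ : (fun s => _) = fun s => -1 * g s + f s); first exact: Cc_add.
by apply/funext => s; rewrite mulN1r addrC.
Qed.

Lemma continuous_sabs (T : topologicalType) (f : T -> K) : continuous f ->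
  continuous (fun t => sabs (f t)).
Proof.
move=> cf t; apply/cvgrPdist_lt => e e0.
apply: filterS (iffLR (cvg_rnormP (X := K^o) f t) (cf t) _ e0) => t'.
by apply: le_lt_trans; exact: sabs_dist.
Qed.

Lemma continuous_Re (T : topologicalType) (f : T -> K) : continuous f ->
  continuous (fun t => Re (f t)).
Proof.
move=> cf t; apply/cvgrPdist_lt => e e0.
apply: filterS (iffLR (cvg_rnormP (X := K^o) f t) (cf t) _ e0) => t'.
by apply: le_lt_trans; rewrite -Re_sub; exact: abs_Re_le.
Qed.

Lemma sabs_cont_supp C f : vcont_supp C (f : G -> K^o) -> cont_supp C (fun s => sabs (f s)).
Proof.
move=> [cf f0]; split=> [|s ns]; first exact: continuous_sabs.
by rewrite f0 // /sabs normr0 Re_zero.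
Qed.

Lemma Re_cont_supp C f : vcont_supp C (f : G -> K^o) -> cont_supp C (fun s => Re (f s)).
Proof. by move=> [cf f0]; split=> [|s ns]; [exact: continuous_Re|rewrite f0 // Re_zero]. Qed.

Lemma Im_cont_supp C f : vcont_supp C (f : G -> K^o) -> cont_supp C (fun s => Im (f s)).
Proof.
move=> [cf f0]; under eq_fun do rewrite Im_Re_negI.
apply: Re_cont_supp; split=> [s|s ns]; last by rewrite f0 // mulr0.
by apply: cvgM; [exact: cvg_cst|exact: cf].
Qed.

Lemma real_scalar_continuous (u : G -> R) : continuous u -> continuous (fun s => rc (u s) : K^o).
Proof.
move=> cu s; apply/(cvg_rnormP (X := K^o)) => e e0.
have /cvgrPdist_lt/(_ e e0) := cu s; apply: filterS => t.
by rewrite -rcB /rnorm -/(sabs _) sabs_rc.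
Qed.

Lemma Re_Im_continuous f : continuous (fun s => Re (f s)) -> continuous (fun s => Im (f s)) ->
  continuous f.
Proof.
move=> cR cI s; apply/(cvg_rnormP (X := K^o)) => e e0.
have e20 : 0 < e / 2 by rewrite divr_gt0.
have /cvgrPdist_lt/(_ _ e20) := cR s; have /cvgrPdist_lt/(_ _ e20) := cI s.
apply: filterS2 => t hI hR; apply: le_lt_trans (sabs_le _) _.
rewrite Re_sub Im_Re_negI mulrBr Re_sub -!Im_Re_negI; lra.
Qed.

Definition L1norm f : R := haar_int (fun s => sabs (f s)).

Definition translate (r : G) f : G -> K := fun s => f (r^-1 * s)%g.

Lemma vcont_supp_translate (X : normedModType K) C (F : G -> X) r :
  vcont_supp C F -> vcont_supp [set s | C (r^-1 * s)%g] (fun s => F (r^-1 * s)%g).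
Proof.
move=> [cF F0]; split=> [s|s /= ns]; last exact: F0.
apply: (@continuous_comp _ _ _ (fun s => (r^-1 * s)%g) F);
  [exact: continuous_mull | exact: cF].
Qed.

Lemma Cc_translate r f : Cc f -> Cc (translate r f).
Proof.
move=> /CcP[C cC Cf]; apply/CcP; exists [set s | C (r^-1 * s)%g]; first exact: compact_mull.
exact: vcont_supp_translate.
Qed.

Lemma translateM r s f : translate (r * s)%g f = translate r (translate s f).
Proof. by apply/funext => t; rewrite /translate invgM mulgA. Qed.

Lemma L1norm_translate r f : Cc f -> L1norm (translate r f) = L1norm f.
Proof.
move=> /CcP[C cC Cf].
exact: (haar_int_translate r^-1%g cC (sabs_cont_supp Cf)).
Qed.

Lemma continuous_translate f : continuous f ->
  continuous (fun p : G * G => f (p.1^-1 * p.2)%g).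
Proof.
move=> cf p; apply: (@continuous_comp _ _ _ (fun p : G * G => (p.1^-1 * p.2)%g) f); last exact: cf.
apply: (@continuous_comp _ _ _ (fun p : G * G => (p.1^-1%g, p.2)) (fun p : G * G => (p.1 * p.2)%g)).
  apply: cvg_pair => /=; last exact: cvg_snd.
  apply: (@continuous_comp _ _ _ fst (fun x : G => x^-1%g)); first exact: cvg_fst.
  exact: invg_continuous.
exact: mulg_continuous.
Qed.

Lemma compact_product C C' : compact C -> compact C' ->
  compact [set (p.1 * p.2)%g | p in C `*` C'].
Proof.
move=> cC cC'; apply: continuous_compact; last exact: compact_setX.
by apply: continuous_subspaceT; exact: mulg_continuous.
Qed.

(** Near 1 the translates of f stay supported in one compact set, on which they
    converge uniformly to f. *)
Lemma L1norm_translate_small f e : Cc f -> 0 < e ->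
  \forall r \near (1%g : G), L1norm (fun s => translate r f s - f s) <= e.
Proof.
move=> /CcP[C cC Cf] e0.
have [V [V1 cV _]] := exists_compact_nbhs 1%g.
pose C' := [set (p.1 * p.2)%g | p in V `*` C].
have cC' : compact C' by exact: compact_product.
have CC' : C `<=` C'.
  by move=> s Cs; exists (1%g, s); [split=> //=; exact: nbhs_singleton | rewrite /= mul1g].
have m0 := haar_size_ge0 C'.
have d0 : 0 < e / (haar_size C' + 1) by rewrite divr_gt0 //; lra.
have ch : continuous (fun p : G * G => sabs (f (p.1^-1 * p.2)%g - f p.2)).
  apply: continuous_sabs => p; apply: cvgB; first exact: continuous_translate Cf.1 p.
  apply: (@continuous_comp _ _ _ snd f); [exact: cvg_snd | exact: Cf.1].
have := @uniform_near (fun r s => sabs (f (r^-1 * s)%g - f s)) C' 1%g _ ch cC' d0.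
apply: filterS2 V1 => r Vr hr.
have Cr : vcont_supp C' ((fun s => translate r f s - f s) : G -> K^o).
  split=> [s|s nC'].
    apply: cvgB; last exact: Cf.1.
    exact: (vcont_supp_translate r Cf).1.
  rewrite /translate !Cf.2 ?subrr //; first by move=> /CC'.
  move=> Cs; apply: nC'; exists (r, (r^-1 * s)%g) => //=.
  by rewrite mulVKg.
apply: (@le_trans _ _ (e / (haar_size C' + 1) * haar_size C')); last first.
  by rewrite mulrAC ler_pdivrMr; [rewrite ler_pM2l //; lra | lra].
apply: le_trans (ler_norm _) _.
apply: (haar_int_bound cC'); first exact: sabs_cont_supp.
move=> s /hr; rewrite invg1 mul1g subrr {2}/sabs normr0 Re_zero subr0 => /ltW.
by [].
Qed.

(** Linearity over K of the integral, which is defined by real and imaginary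
    parts. *)
Lemma Re_scalar_integralZ C (h : G -> K) z : compact C -> vcont_supp C (h : G -> K^o) ->
  Re (scalar_integral mu h * z) = haar_int (fun s => Re (h s * z)).
Proof.
move=> cC Ch; rewrite Re_mul Re_scalar_integral Im_scalar_integral.
rewrite mulrC [_ * Im z]mulrC.
rewrite -(haar_intZ _ cC (Re_cont_supp Ch)).
rewrite -(haar_intZ _ cC (Im_cont_supp Ch)).
rewrite -(haar_intB cC).
- by congr haar_int; apply/funext => s; rewrite Re_mul; ring.
- by apply: cont_suppZ; exact: Re_cont_supp.
- by apply: cont_suppZ; exact: Im_cont_supp.
Qed.

Lemma convolution_slice C f g s : vcont_supp C (f : G -> K^o) -> continuous g ->
  vcont_supp C ((fun r => f r * g (r^-1 * s)%g) : G -> K^o).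
Proof.
move=> [cf f0] cg; split=> [r|r nr]; last by rewrite f0 // mul0r.
apply: cvgM; first exact: cf.
apply: (@continuous_comp _ _ _ (fun r => (r, s)) (fun p : G * G => g (p.1^-1 * p.2)%g)).
  by apply: cvg_pair => /=; [exact: cvg_id | exact: cvg_cst].
exact: continuous_translate.
Qed.

Lemma convolution_supp C C' f g : compact C -> compact C' ->
  vcont_supp C (f : G -> K^o) -> vcont_supp C' (g : G -> K^o) ->
  vcont_supp [set (p.1 * p.2)%g | p in C `*` C'] ((convolution mu f g) : G -> K^o).
Proof.
move=> cC cC' Cf Cg.
have fg0 r s : ~ C r -> f r * g (r^-1 * s)%g = 0 by move=> /Cf.2 ->; rewrite mul0r.
have cfg : continuous (fun p : G * G => f p.2 * g (p.2^-1 * p.1)%g).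
  move=> p; apply: cvgM.
    by apply: (@continuous_comp _ _ _ snd f); [exact: cvg_snd | exact: Cf.1].
  apply: (@continuous_comp _ _ _ (fun p : G * G => (p.2, p.1)) (fun p : G * G => g (p.1^-1 * p.2)%g)).
    by apply: cvg_pair => /=; [exact: cvg_snd | exact: cvg_fst].
  exact: continuous_translate Cg.1 _.
split.
  apply: Re_Im_continuous.
    under eq_fun do rewrite Re_scalar_integral.
    apply: (@continuous_haar_int (fun s r => Re (f r * g (r^-1 * s)%g)) C) => //.
      exact: continuous_Re cfg.
    by move=> r s /fg0 ->; rewrite Re_zero.
  under eq_fun do rewrite Im_scalar_integral.
  apply: (@continuous_haar_int (fun s r => Im (f r * g (r^-1 * s)%g)) C) => //.
    under eq_fun do rewrite Im_Re_negI.
    by apply: continuous_Re => p; apply: cvgM; [exact: cvg_cst | exact: cfg].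
  by move=> r s /fg0 ->; rewrite Im_Re_negI mulr0 Re_zero.
move=> s ns.
have h0 : (fun r => f r * g (r^-1 * s)%g) = fun=> 0.
  apply/funext => r; have [Cr|/fg0//] := pselect (C r).
  rewrite Cg.2 ?mulr0 // => Cs; apply: ns; exists (r, (r^-1 * s)%g) => //=.
  by rewrite mulVKg.
rewrite /convolution h0.
apply: scalar_ext; rewrite ?Re_scalar_integral ?Im_scalar_integral.
  by rewrite Re_zero /haar_int Rintegral_cst // mul0r.
by rewrite Im_Re_negI mulr0 Re_zero /haar_int Rintegral_cst // mul0r.
Qed.

Lemma Cc_convolution f g : Cc f -> Cc g -> Cc (convolution mu f g).
Proof.
move=> /CcP[C cC Cf] /CcP[C' cC' Cg]; apply/CcP.
by exists [set (p.1 * p.2)%g | p in C `*` C']; [exact: compact_product|exact: convolution_supp].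
Qed.

(** * The integrated operators of an isometric representation *)

Section Rep.
Variable X : completeNormedModType K.
Variable U : G -> X -> X.

Definition isometric_rep := [/\ group_representation U, isometric U & strongly_continuous U].
Hypothesis HU : isometric_rep.
Local Notation IO := (integrated_operator mu U).

Lemma rep_linear r : linear (U r).
Proof. by have [[/(_ r)[[]]]] := HU. Qed.
Lemma rep_bounded r : bounded_operator (U r).
Proof. by have [[/(_ r)[]]] := HU. Qed.
Lemma rep_mul r s x : U (r * s)%g x = U r (U s x).
Proof. by have [[_ ->]] := HU. Qed.
Lemma rep_norm r x : rnorm (U r x) = rnorm x.
Proof. by have [_ h _] := HU; rewrite /rnorm h. Qed.
Lemma rep_cont x : continuous (fun r => U r x).
Proof. by have [_ _ h] := HU; exact: h. Qed.

(** U_1 is idempotent and injective. *)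
Lemma rep_one x : U 1%g x = x.
Proof.
have : U 1%g (U 1%g x - x) = 0.
  by rewrite (linear_sub (rep_linear _)) -rep_mul mulg1 subrr.
move=> h; have := rep_norm 1%g (U 1%g x - x); rewrite h rnorm0 => /esym/rnorm_eq0/eqP.
by rewrite subr_eq0 => /eqP.
Qed.

Lemma integrated_supp C f x : vcont_supp C (f : G -> K^o) -> vcont_supp C (fun s => f s *: U s x).
Proof.
move=> [cf f0]; split=> [s|s ns]; last by rewrite f0 // scale0r.
by apply: cvgZ; [exact: cf | exact: rep_cont].
Qed.

Lemma integrated_linear f : Cc f -> linear (IO f).
Proof.
move=> /CcP[C cC Cf] c x y; rewrite /integrated_operator.
rewrite -(vector_integralD cC c (integrated_supp x Cf) (integrated_supp y Cf)).
congr vector_integral; apply/funext => s.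
by rewrite rep_linear scalerDr !scalerA mulrC.
Qed.

Lemma integrated_addf c f g x : Cc f -> Cc g -> IO (fun s => c * f s + g s) x = c *: IO f x + IO g x.
Proof.
move=> Cf Cg; have [C [cC Cf' Cg']] := Cc_common Cf Cg.
rewrite /integrated_operator -(vector_integralD cC c (integrated_supp x Cf') (integrated_supp x Cg')).
by congr vector_integral; apply/funext => s; rewrite scalerDl scalerA.
Qed.

Lemma integrated_subf f g x : Cc f -> Cc g -> IO (fun s => f s - g s) x = IO f x - IO g x.
Proof.
move=> Cf Cg; rewrite (_ : (fun s => _) = fun s => -1 * g s + f s).
  by rewrite integrated_addf // scaleN1r addrC.
by apply/funext => s; rewrite mulN1r addrC.
Qed.

Lemma integrated_norm f x : Cc f -> rnorm (IO f x) <= L1norm f * rnorm x.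
Proof.
move=> /CcP[C cC Cf]; rewrite mulrC /L1norm.
rewrite -(haar_intZ _ cC (sabs_cont_supp Cf)).
apply: (rnorm_vector_integral cC (integrated_supp x Cf)).
  by apply: cont_suppZ; exact: sabs_cont_supp.
by move=> s; rewrite rnormZ rep_norm mulrC.
Qed.

Lemma integrated_translate r f x : Cc f -> IO (translate r f) x = U r (IO f x).
Proof.
move=> /CcP[C cC Cf]; rewrite /integrated_operator.
rewrite (vector_integral_bounded cC (integrated_supp x Cf) (rep_bounded r)).
rewrite -(vector_integral_translate (compact_mull (r:=r) cC) r
  (integrated_supp x (vcont_supp_translate r Cf))).
congr vector_integral; apply/funext => s /=.
by rewrite (linear_scale (rep_linear r)) -rep_mul /translate mulKg.
Qed.

(** Tested on phi, both sides are iterated integrals of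
    f(r) g(r^-1 s) phi (U_s x), in opposite orders; the substitution of r^-1 s
    for s is integrated_translate. *)
Lemma integrated_convolution f g x : Cc f -> Cc g -> IO (convolution mu f g) x = IO f (IO g x).
Proof.
move=> /CcP[C cC Cf] Cg0; have /CcP[C' cC' Cg] := Cg0.
apply: separating_functionals => phi cphi.
pose D := [set (p.1 * p.2)%g | p in C `*` C'].
have cD : compact D by exact: compact_product.
have CD : vcont_supp D ((convolution mu f g) : G -> K^o) by exact: convolution_supp.
rewrite (vector_integralP cD (integrated_supp x CD) cphi).
rewrite (vector_integralP cC (integrated_supp _ Cf) cphi).
pose h r s := Re ((f r * g (r^-1 * s)%g) * phi (U s x)).
have -> : (fun s => Re (phi (convolution mu f g s *: U s x))) =
   fun s => haar_int (fun r => h r s).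
  apply/funext => s; rewrite linearZ /=.
  exact: (Re_scalar_integralZ _ cC (convolution_slice s Cf Cg.1)).
have -> : (fun s => Re (phi (f s *: U s (IO g x)))) = fun r => haar_int (h r).
  apply/funext => r; rewrite linearZ /= -integrated_translate //.
  have cphi' := scale_functional_continuous (c := f r) cphi.
  have Ct := integrated_supp x (vcont_supp_translate r Cg).
  have := vector_integralP (compact_mull (r:=r) cC') Ct cphi'.
  rewrite -/(IO (translate r g) x) => e; apply: etrans e _.
  congr haar_int; apply/funext => s; rewrite /h /= /scale_functional linearZ /=.
  by rewrite -[LHS]/(Re (f r * (g (r^-1 * s)%g * phi (U s x)))) mulrA.
symmetry; apply: (fubini _ cC cD).
- apply: continuous_Re => p; apply: cvgM; first apply: cvgM.
  + by apply: (@continuous_comp _ _ _ fst f); [exact: cvg_fst | exact: Cf.1].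
  + exact: continuous_translate Cg.1 p.
  + apply: (@continuous_comp _ _ _ (fun p : G * G => U p.2 x) phi); last exact: cphi.
    apply: (@continuous_comp _ _ _ snd (fun s => U s x)); [exact: cvg_snd | exact: rep_cont].
- by move=> r s /Cf.2; rewrite /h => ->; rewrite !mul0r Re_zero.
- move=> r s nD; have [Cr|/Cf.2] := pselect (C r); last by rewrite /h => ->; rewrite !mul0r Re_zero.
  rewrite /h Cg.2 ?mulr0 ?mul0r ?Re_zero // => Cs; apply: nD; exists (r, (r^-1 * s)%g) => //=.
  by rewrite mulVKg.
Qed.

(** U(u) x - x is the average of the vectors U_s x - x for the density u. *)
Lemma integrated_near_one C (u : G -> R) e x : compact C -> cont_supp C u -> (forall s, 0 <= u s) ->
  haar_int u = 1 -> (forall s, C s -> rnorm (U s x - x) <= e) ->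
  rnorm (IO (fun s => rc (u s)) x - x) <= e.
Proof.
move=> cC Cu u0 u1 Ue.
have Cru : vcont_supp C ((fun s => rc (u s)) : G -> K^o).
  split; first exact: real_scalar_continuous Cu.1.
  by move=> s /Cu.2 ->; rewrite rc0.
have Cx y : vcont_supp C (fun s => rc (u s) *: (y : X)).
  split=> [s|s ns]; last by rewrite Cru.2 // scale0r.
  by apply: cvgZ; [exact: Cru.1|exact: cvg_cst].
have ux : vector_integral mu (fun s => rc (u s) *: x) = x.
  apply: vector_integral_unique => phi cphi.
  rewrite -[LHS]mulr1 -u1 -(haar_intZ _ cC Cu).
  by congr haar_int; apply/funext => s; rewrite linearZ /= Re_rcM mulrC.
rewrite -[in X in _ - X]ux addrC -scaleN1r.
rewrite -(vector_integralD cC (-1) (Cx x) (integrated_supp x Cru)).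
have Cd := vcont_suppD (-1) (Cx x) (integrated_supp x Cru).
apply: le_trans (rnorm_vector_integral cC (g := fun s => e * u s) Cd _ _) _.
- exact: cont_suppZ.
- move=> s; rewrite scaleN1r addrC -scalerBr rnormZ sabs_rc ger0_norm // mulrC.
  have [Cs|ns] := pselect (C s); first by rewrite ler_wpM2r // Ue.
  by rewrite Cu.2 // !mulr0.
- by rewrite (haar_intZ _ cC Cu) u1 mulr1.
Qed.
End Rep.

(** * Integrated forms *)

Variable calX : completeNormedModType K -> Prop.
Variable A : banachAlgebraType K.
Variable q : (G -> K) -> A.
Hypothesis Aq : is_crossed_product mu (isometric_representations calX) q.
Local Notation calR := (@isometric_representations R k G calX).
Local Notation IO U := (integrated_operator mu (bact U)).

Lemma calR_rep U : calR U -> isometric_rep (bact U).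
Proof. by case. Qed.

Lemma q_lin (c : K) f g : Cc f -> Cc g -> q (fun s => c * f s + g s) = c *: q f + q g.
Proof. by case: Aq => h _ _ _; exact: h. Qed.

Lemma q_conv f g : Cc f -> Cc g -> q (convolution mu f g) = bmul (q f) (q g).
Proof. by case: Aq => _ h _ _; exact: h. Qed.

Lemma q_sub f g : Cc f -> Cc g -> q (fun s => f s - g s) = q f - q g.
Proof.
move=> Cf Cg; rewrite (_ : (fun s => _) = fun s => -1 * g s + f s).
  by rewrite q_lin // scaleN1r addrC.
by apply/funext => s; rewrite mulN1r addrC.
Qed.

Lemma q_dense a e : 0 < e -> exists2 f, Cc f & rnorm (a - q f) < e.
Proof.
case: Aq => _ _ _ /dense_rnormP h e0.
by have [_ [f Cf <-] hf] := h a e e0; exists f.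
Qed.

(** This bound and q_norm_le say that the norm of q f is the supremum over the
    class of the norms of the operators U(f). *)
Lemma integrated_le_q U f x : calR U -> Cc f -> rnorm (IO U f x) <= rnorm (q f) * rnorm x.
Proof.
move=> RU Cf.
have lin := linear_scale (integrated_linear (calR_rep RU) Cf).
apply: (iffLR (opnorm_le lin (rnorm_ge0 _))).
case: Aq => _ _ -> // _.
by apply: ereal_sup_ubound; exists U.
Qed.

Lemma q_norm_le f M : 0 <= M -> Cc f ->
  (forall U x, calR U -> rnorm (IO U f x) <= M * rnorm x) -> rnorm (q f) <= M.
Proof.
move=> M0 Cf h; rewrite -lee_fin; case: Aq => _ _ -> // _.
apply: ge_ereal_sup => _ [U RU ->].
have lin := linear_scale (integrated_linear (calR_rep RU) Cf).
by apply/(opnorm_le lin M0) => x; exact: h.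
Qed.

Lemma L1norm_ge0 (f : G -> K) : 0 <= L1norm f.
Proof. by apply: haar_int_ge0 => s; exact: sabs_ge0. Qed.

Lemma q_le_L1 f : Cc f -> rnorm (q f) <= L1norm f.
Proof.
move=> Cf; apply: q_norm_le => // [|U x RU]; first exact: L1norm_ge0.
exact: (integrated_norm (calR_rep RU)).
Qed.

Lemma rnorm_bmul (a b : A) : rnorm (bmul a b) <= rnorm a * rnorm b.
Proof. by rewrite -(le_rc k) rcM -!normE; exact: normr_bmul. Qed.

Lemma bmul_subl (a b c : A) : bmul (a - b) c = bmul a c - bmul b c.
Proof. by rewrite bmulDl -scaleN1r bmulZl scaleN1r. Qed.
Lemma bmul_subr (a b c : A) : bmul c (a - b) = bmul c a - bmul c b.
Proof. by rewrite bmulDr -scaleN1r bmulZr scaleN1r. Qed.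

(** Identities between expressions that are Lipschitz in an element of A need only
    be verified on the image of Cc(G). *)
Lemma eq_on_dense (X : normedModType K) (f1 f2 : A -> X) M1 M2 :
  (forall a b, rnorm (f1 a - f1 b) <= M1 * rnorm (a - b)) ->
  (forall a b, rnorm (f2 a - f2 b) <= M2 * rnorm (a - b)) ->
  (forall f, Cc f -> f1 (q f) = f2 (q f)) -> forall a, f1 a = f2 a.
Proof.
move=> h1 h2 h a; apply/eqP; rewrite -subr_eq0; apply/eqP; apply: rnorm_small => e e0.
have M0 : 0 < `|M1| + `|M2| + 1 by have := normr_ge0 M1; have := normr_ge0 M2; lra.
have d0 : 0 < e / (`|M1| + `|M2| + 1) by rewrite divr_gt0.
have [f Cf] := q_dense a d0; rewrite ltr_pdivlMr // => af.
apply: le_trans (rnorm_tri (f1 (q f)) _ _) _.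
have := h1 a (q f); have := h2 a (q f); rewrite h // (rnormBC (f2 a)).
have := rnorm_ge0 (a - q f); have := ler_norm M1; have := ler_norm M2.
move=> b1 b2 b3 b4 b5.
have : M1 * rnorm (a - q f) <= `|M1| * rnorm (a - q f) by rewrite ler_wpM2r.
have : M2 * rnorm (a - q f) <= `|M2| * rnorm (a - q f) by rewrite ler_wpM2r.
by lra.
Qed.

Definition contractive_rep (X : completeNormedModType K) (T : A -> X -> X) :=
  algebra_representation T /\ contractive T.

Section ContractiveRep.
Variables (X : completeNormedModType K) (T : A -> X -> X).
Hypothesis HT : contractive_rep T.

Lemma crep_linear a : linear (T a).
Proof. by have [[/(_ a)[]]] := HT. Qed.
Lemma crep_mul a b x : T (bmul a b) x = T a (T b x).
Proof. by have [[_ _ ->]] := HT. Qed.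
Lemma crep_lin (c : K) a b x : T (c *: a + b) x = c *: T a x + T b x.
Proof. by have [[_ ->]] := HT. Qed.
Lemma crep_sub a b x : T (a - b) x = T a x - T b x.
Proof. by rewrite addrC -scaleN1r crep_lin scaleN1r addrC. Qed.
Lemma crep_scale (c : K) a x : T (c *: a) x = c *: T a x.
Proof. by apply: (@linear_scale _ _ A X (T ^~ x)) => d b b'; exact: crep_lin. Qed.
Lemma crep_norm a x : rnorm (T a x) <= rnorm a * rnorm x.
Proof.
have [_ /(_ a) h] := HT.
exact: (iffLR (opnorm_le (linear_scale (crep_linear a)) (rnorm_ge0 a)) h).
Qed.
Lemma crep_evaluation x : bounded_operator (T ^~ x).
Proof.
apply/bounded_operatorP; split; first by move=> c a b; exact: crep_lin.
by exists (rnorm x) => [|a]; [exact: rnorm_ge0 | rewrite mulrC; exact: crep_norm].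
Qed.
End ContractiveRep.

Lemma crep_unique (X : completeNormedModType K) (T T' : A -> X -> X) :
  contractive_rep T -> contractive_rep T' ->
  (forall f, Cc f -> T (q f) = T' (q f)) -> T = T'.
Proof.
move=> HT HT' h; apply/funext => a; apply/funext => x.
apply: (@eq_on_dense X (T ^~ x) (T' ^~ x) (rnorm x) (rnorm x)).
- by move=> b c; rewrite -(crep_sub HT) mulrC; exact: crep_norm.
- by move=> b c; rewrite -(crep_sub HT') mulrC; exact: crep_norm.
- by move=> f Cf; rewrite h.
Qed.

(** Probability densities supported in V; as V shrinks to 1 they form an
    approximate unit. *)
Definition density (V : set G) (u : G -> R) :=
  exists C, [/\ compact C, C `<=` V, cont_supp C u, (forall s, 0 <= u s) & haar_int u = 1].

Lemma exists_density (V : set G) : nbhs (1%g : G) V -> exists u, density V u.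
Proof.
move=> V1; have [C [u [cC CV Cu u0 u1]]] := exists_bump V1.
by exists u, C.
Qed.

Lemma density_sub (V W : set G) u : V `<=` W -> density V u -> density W u.
Proof. by move=> VW [C [cC CV Cu u0 u1]]; exists C; split=> // s /CV/VW. Qed.

Lemma density_Cc V u : density V u -> Cc (rc \o u).
Proof.
move=> [C [cC CV Cu u0 u1]].
apply/(CcP); exists C => //; split; first exact: real_scalar_continuous Cu.1.
by move=> s /Cu.2 /= ->; rewrite rc0.
Qed.

Section IntegratedForm.
Variable U : banach_action R k G.
Hypothesis RU : calR U.

(** U(f) x is a Cauchy family as q f tends to a, since the difference of two
    members is bounded by the norm of q (f - g). *)
Let integrated_limit a x : exists l, forall f, Cc f -> rnorm (IO U f x - l) <= rnorm (q f - a) * rnorm x.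
Proof.
have [||l lP] := @complete_approx R k (bspace U)
  (fun e => [set y | exists f, [/\ Cc f, y = IO U f x & rnorm (q f - a) * rnorm x <= e]]).
- move=> e e0; have x1 : 0 < rnorm x + 1 by have := rnorm_ge0 x; lra.
  have d0 : 0 < e / (rnorm x + 1) by rewrite divr_gt0.
  have [f Cf] := q_dense a d0; rewrite ltr_pdivlMr // => h.
  exists (IO U f x), f; split=> //; rewrite rnormBC.
  by have := rnorm_ge0 (a - q f); lra.
- move=> e e' _ _ e0 e'0 [f [Cf -> fe]] [g [Cg -> ge]].
  rewrite -(integrated_subf (calR_rep RU)) //.
  apply: le_trans (integrated_le_q _ RU (Cc_sub Cf Cg)) _.
  rewrite q_sub //; have := rnorm_tri a (q f) (q g); rewrite (rnormBC a) => h.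
  have := ler_wpM2r (rnorm_ge0 x) h; lra.
exists l => f Cf; apply/ler_addgt0Pr => d d0; apply: lP; last first.
  by exists f; split => //; rewrite lerDl ltW.
by rewrite ltr_wpDl // mulr_ge0 // rnorm_ge0.
Qed.

Let T a x : bspace U := projT1 (cid (integrated_limit a x)).

Let TP a x f : Cc f -> rnorm (IO U f x - T a x) <= rnorm (q f - a) * rnorm x.
Proof. by move=> Cf; exact: (projT2 (cid (integrated_limit a x))). Qed.

Let Tq f x : Cc f -> T (q f) x = IO U f x.
Proof.
move=> Cf; apply/eqP; rewrite -subr_eq0; apply/eqP; apply: rnorm_small => e /ltW e0.
by rewrite rnormBC; apply: le_trans (TP _ _ Cf) _; rewrite subrr rnorm0 mul0r.
Qed.

Let T_lip x a b : rnorm (T a x - T b x) <= rnorm x * rnorm (a - b).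
Proof.
apply/ler_addgt0Pr => e e0; have x0 := rnorm_ge0 x.
have x1 : 0 < 4 * (rnorm x + 1) by lra.
have d0 : 0 < e / (4 * (rnorm x + 1)) by rewrite divr_gt0.
have [f Cf] := q_dense a d0; have [g Cg] := q_dense b d0.
set d := _ / _ in d0 *.
have dE : e = d * (4 * (rnorm x + 1)) by rewrite /d mulfVK // gt_eqF.
move=> bg af.
have h1 := TP a x Cf; have h2 := TP b x Cg.
have h3 := integrated_le_q x RU (Cc_sub Cf Cg).
rewrite q_sub // (integrated_subf (calR_rep RU)) // in h3.
have h4 : rnorm (q f - q g) <= rnorm (a - b) + d + d.
  have := rnorm_tri a (q f) (q g); have := rnorm_tri b a (q g); rewrite (rnormBC (q f) a); lra.
have := rnorm_tri (IO U f x) (T a x) (T b x); have := rnorm_tri (IO U g x) (IO U f x) (T b x).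
rewrite (rnormBC (T a x) (IO U f x)) => h6 h5.
have h7 := ler_wpM2r x0 h4.
have h8 : rnorm (q f - a) * rnorm x <= d * rnorm x by rewrite ler_wpM2r // rnormBC ltW.
have h9 : rnorm (q g - b) * rnorm x <= d * rnorm x by rewrite ler_wpM2r // rnormBC ltW.
by lra.
Qed.

Let T_norm a x : rnorm (T a x) <= rnorm a * rnorm x.
Proof.
have T0 : T 0 x = 0.
  have q0 : q (fun=> 0) = 0.
    rewrite -(subrr (q (fun=> 0))) -q_sub; [|exact: Cc_zero..].
    by congr (q _); apply/funext => s; rewrite subrr.
  rewrite -q0 Tq; last exact: Cc_zero.
  apply: rnorm_eq0; apply/eqP; rewrite eq_le rnorm_ge0 andbT.
  apply: le_trans (integrated_le_q x RU (Cc_zero)) _.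
  by rewrite q0 rnorm0 mul0r.
by have := T_lip x a 0; rewrite T0 !subr0 mulrC.
Qed.

Let T_linear a : linear (T a).
Proof.
move=> c x y.
apply: (@eq_on_dense (bspace U) (fun a => T a (c *: x + y)) (fun a => c *: T a x + T a y)
   (rnorm (c *: x + y)) (sabs c * rnorm x + rnorm y)).
- exact: T_lip.
- move=> b b'; rewrite opprD addrACA -scalerBr mulrDl; apply: le_trans (rnormD _ _) _.
  by rewrite rnormZ lerD // -mulrA ler_wpM2l ?sabs_ge0.
- by move=> f Cf; rewrite !Tq // (integrated_linear (calR_rep RU) Cf).
Qed.

Let T_lin (c : K) a b x : T (c *: a + b) x = c *: T a x + T b x.
Proof.
apply: (@eq_on_dense (bspace U) (fun b => T (c *: a + b) x) (fun b => c *: T a x + T b x)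
   (rnorm x) (rnorm x)).
- by move=> b1 b2; apply: le_trans (T_lip _ _ _) _; rewrite opprD addrACA subrr add0r.
- by move=> b1 b2; rewrite opprD addrACA subrr add0r.
move=> g Cg; apply: (@eq_on_dense (bspace U) (fun a => T (c *: a + q g) x) (fun a => c *: T a x + T (q g) x)
   (rnorm x * sabs c) (sabs c * rnorm x)).
- move=> b1 b2; apply: le_trans (T_lip _ _ _) _.
  by rewrite opprD addrACA subrr addr0 -scalerBr rnormZ mulrA.
- move=> b1 b2; rewrite opprD addrACA subrr addr0 -scalerBr rnormZ -mulrA.
  by rewrite ler_wpM2l ?sabs_ge0.
move=> f Cf; rewrite -q_lin // !Tq //; last exact: Cc_add.
exact: (integrated_addf (calR_rep RU)).
Qed.

Let T_mul a b x : T (bmul a b) x = T a (T b x).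
Proof.
apply: (@eq_on_dense (bspace U) (fun b => T (bmul a b) x) (fun b => T a (T b x))
   (rnorm x * rnorm a) (rnorm a * rnorm x)).
- move=> b1 b2; apply: le_trans (T_lip _ _ _) _.
  by rewrite -bmul_subr -mulrA ler_wpM2l ?rnorm_ge0 ?rnorm_bmul.
- move=> b1 b2; rewrite -(linear_sub (T_linear a)); apply: le_trans (T_norm _ _) _.
  by rewrite -mulrA ler_wpM2l ?rnorm_ge0.
move=> g Cg; apply: (@eq_on_dense (bspace U) (fun a => T (bmul a (q g)) x) (fun a => T a (T (q g) x))
   (rnorm x * rnorm (q g)) (rnorm (T (q g) x))).
- move=> b1 b2; apply: le_trans (T_lip _ _ _) _.
  by rewrite -bmul_subl -mulrA ler_wpM2l ?rnorm_ge0 // mulrC rnorm_bmul.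
- exact: T_lip.
move=> f Cf; rewrite -q_conv // !Tq //; last exact: Cc_convolution.
exact: (integrated_convolution (calR_rep RU)).
Qed.

Lemma integrated_form_exists : exists S : A -> bspace U -> bspace U,
  [/\ algebra_representation S, contractive S &
      forall f, Cc f -> S (q f) = IO U f].
Proof.
exists T; split.
- split=> //.
    move=> a; apply/bounded_operatorP; split=> //.
    by exists (rnorm a); [exact: rnorm_ge0 | exact: T_norm].
  by move=> a b; apply/funext => x; exact: T_mul.
- move=> a; exact: (iffRL (opnorm_le (linear_scale (T_linear a)) (rnorm_ge0 a)) (T_norm a)).
- by move=> f Cf; apply/funext => x; exact: Tq.
Qed.

Local Notation UR := (bact (integrated_form mu q U)).

Lemma integrated_formP : contractive_rep UR /\ forall f, Cc f -> UR (q f) = IO U f.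
Proof.
rewrite /integrated_form /=; case: xgetP => [S _ [h1 h2 h3]|]; first by split.
by have [S SP] := integrated_form_exists; move=> /(_ S).
Qed.

Lemma integrated_form_crep : contractive_rep UR.
Proof. by have [] := integrated_formP. Qed.
Lemma integrated_form_q f x : Cc f -> UR (q f) x = IO U f x.
Proof. by have [_ h] := integrated_formP => Cf; rewrite h. Qed.

Lemma integrated_form_unique (S : A -> bspace U -> bspace U) : contractive_rep S ->
  (forall f, Cc f -> S (q f) = IO U f) -> UR = S.
Proof.
move=> HS Sq; apply: crep_unique => //; first exact: integrated_form_crep.
by move=> f Cf; rewrite Sq //; apply/funext => x; exact: integrated_form_q.
Qed.

(** U(translate r u) = U_r U(u), and U(u) x is close to x. The densities do not
    depend on the representation, so the same u serves two representations at
    once. *)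
Lemma rep_near x e : 0 < e -> exists2 V, nbhs (1%g : G) V &
  forall u r, density V u -> rnorm (IO U (translate r (rc \o u)) x - bact U r x) <= e.
Proof.
move=> e0; have HU := calR_rep RU.
exists [set s | rnorm (bact U s x - x) <= e].
  have cx : continuous (fun r => bact U r x) by exact: rep_cont.
  have := iffLR (cvg_rnormP _ _) (cx (1%g : G)) e e0.
  by apply: filterS => s; rewrite (rep_one HU) rnormBC => /ltW.
move=> u r du; have [C [cC CV Cu u0 u1]] := du.
rewrite (integrated_translate HU _ _ (density_Cc du)).
rewrite -(linear_sub (rep_linear HU r)) (rep_norm HU).
exact: (integrated_near_one HU cC).
Qed.

Lemma rep_approx r x e : 0 < e -> exists2 f, Cc f & rnorm (IO U f x - bact U r x) <= e.
Proof.
move=> e0; have [V V1 h] := rep_near x e0.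
have [u du] := exists_density V1.
exists (translate r (rc \o u)); last exact: h.
by apply: Cc_translate => //; exact: density_Cc du.
Qed.

Lemma integrated_form_representation :
  nondegenerate_contractive_representations calX (integrated_form mu q U).
Proof.
have [h1 h2] := integrated_form_crep.
split=> //; first by case: RU.
apply/dense_rnormP => x e e0; have e20 : 0 < e / 2 by rewrite divr_gt0.
have [f Cf] := rep_approx 1%g x e20; rewrite (rep_one (calR_rep RU)) => h.
exists (IO U f x); last by rewrite rnormBC; lra.
exists 1%N, (fun=> 1), (fun=> IO U f x); split; last by rewrite big_ord1 scale1r.
by move=> _; exists (q f), x; rewrite integrated_form_q.
Qed.

(** U_r x is a limit of vectors U(f) x, and these are limits of linear combinations
    of vectors U_s x. *)
Lemma integrated_form_subspaces :
  closed_invariant_subspaces (integrated_form mu q U) = closed_invariant_subspaces U.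
Proof.
have HT := integrated_form_crep; have HU := calR_rep RU.
apply/seteqP; split=> Y [cY sY iY]; split=> //.
- move=> r x Yx; apply: closed_rnorm => // e e0.
  have e20 : 0 < e / 2 by rewrite divr_gt0.
  have [f Cf h] := rep_approx r x e20.
  exists (IO U f x); last by rewrite rnormBC; lra.
  by rewrite -integrated_form_q //; exact: iY.
- move=> a x Yx; apply: closed_rnorm => // e e0.
  have x1 : 0 < rnorm x + 1 by have := rnorm_ge0 x; lra.
  have d0 : 0 < e / (rnorm x + 1) by rewrite divr_gt0.
  have [f Cf] := q_dense a d0; rewrite ltr_pdivlMr // => h.
  exists (IO U f x).
    have /(CcP)[C cC Cf'] := Cf.
    apply: (vector_integral_subspace cC (integrated_supp HU x Cf') cY sY) => s.
    rewrite -[X in Y X]addr0; apply: sY.2; [exact: iY | exact: sY.1].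
  rewrite -integrated_form_q // -(crep_sub HT).
  apply: le_lt_trans (crep_norm HT _ _) _.
  by have := rnorm_ge0 (a - q f); lra.
Qed.
End IntegratedForm.

(** A bounded operator commutes with weak integrals; conversely U_r and V_r are
    limits of integrated operators along the same densities. *)
Lemma integrated_form_intertwiners U V : calR U -> calR V ->
  bounded_intertwiners (integrated_form mu q U) (integrated_form mu q V) =
  bounded_intertwiners U V.
Proof.
move=> RU RV; have HU := calR_rep RU; have HV := calR_rep RV.
have HTU := integrated_form_crep RU; have HTV := integrated_form_crep RV.
apply/seteqP; split=> F [bF iF]; split=> //.
- move=> r x; have /bounded_operatorP[lF [M M0 FM]] := bF.
  apply/eqP; rewrite -subr_eq0; apply/eqP; apply: rnorm_small => e e0.
  have M1 : 0 < M + 1 by lra.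
  have d0 : 0 < e / (M + 1) by rewrite divr_gt0.
  have [W W1 hW] := rep_near RU x d0; have [W' W'1 hW'] := rep_near RV (F x) d0.
  have [u du] := exists_density (filterI W1 W'1).
  have {}hW := hW u r (density_sub (@subIsetl _ _ _) du).
  have {}hW' := hW' u r (density_sub (@subIsetr _ _ _) du).
  have Cu : Cc (translate r (rc \o u)) by apply: Cc_translate => //; exact: density_Cc du.
  set d := e / (M + 1) in d0 hW hW'.
  set f := translate _ _ in hW hW' Cu.
  have dE : e = d * (M + 1) by rewrite /d mulfVK // gt_eqF.
  have h1 : rnorm (F (bact U r x) - IO V f (F x)) <= M * d.
    rewrite -(integrated_form_q RV) // -iF (integrated_form_q RU) // -(linear_sub lF).
    by apply: le_trans (FM _) _; rewrite ler_wpM2l // rnormBC.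
  by apply: le_trans (rnorm_tri (IO V f (F x)) _ _) _; lra.
- move=> a x; have /bounded_operatorP[lF [M M0 FM]] := bF.
  apply: (@eq_on_dense (bspace V) (fun a => F (bact (integrated_form mu q U) a x))
   (fun a => bact (integrated_form mu q V) a (F x)) (M * rnorm x) (rnorm (F x))).
  + move=> b c; rewrite -(linear_sub lF) -(crep_sub HTU).
    apply: le_trans (FM _) _; rewrite -mulrA ler_wpM2l // mulrC; exact: (crep_norm HTU).
  + by move=> b c; rewrite -(crep_sub HTV) mulrC; exact: (crep_norm HTV).
  move=> f Cf; rewrite !integrated_form_q //.
  have /(CcP)[C cC Cf'] := Cf.
  rewrite /integrated_operator.
  rewrite (vector_integral_bounded cC (integrated_supp HU x Cf') bF).
  by congr vector_integral; apply/funext => s /=; rewrite (linear_scale lF) iF.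
Qed.

(** * Representations of the group from representations of the algebra *)

(** Equal bundled actions have equal spaces, along which one of the maps has to be
    transported; by proof irrelevance the transport is trivial when the space is
    the same. *)
Lemma banach_action_inj (S : Type) (X : completeNormedModType K) (T1 T2 : S -> X -> X) :
  BanachAction T1 = BanachAction T2 -> T1 = T2.
Proof.
pose f (w : banach_action R k S) (p : bspace w = X) : S -> X -> X :=
  eq_rect (bspace w) (fun Z : completeNormedModType _ => S -> Z -> Z) (bact w) X p.
have fE w1 w2 p1 p2 : w1 = w2 -> f w1 p1 = f w2 p2.
  by move=> e; subst w2; rewrite (Prop_irrelevance p1 p2).
by move=> e; exact: (fE _ _ (erefl : bspace (BanachAction T1) = X) (erefl : bspace (BanachAction T2) = X) e).
Qed.

(** Both representations are recovered from one integrated form with the same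
    densities. *)
Lemma integrated_form_inj U V : calR U -> calR V ->
  integrated_form mu q U = integrated_form mu q V -> U = V.
Proof.
move=> RU RV e.
have fU := integrated_form_q RU.
have fV := integrated_form_q RV.
have nU := rep_near RU.
have nV := rep_near RV.
have eX : bspace U = bspace V := f_equal (@bspace R k A) e.
case: U V RU RV e eX fU fV nU nV => [X U] [Y V] RU RV e eX; rewrite -[bspace _]/X -[bspace (BanachAction V)]/Y in eX.
subst Y.
have {}e : bact (integrated_form mu q (BanachAction U)) = bact (integrated_form mu q (BanachAction V)).
  exact: (banach_action_inj e).
rewrite e => fU fV nU nV; congr BanachAction.
apply/funext => r; apply/funext => x; apply/eqP; rewrite -subr_eq0; apply/eqP.
apply: rnorm_small => d d0; have d20 : 0 < d / 2 by rewrite divr_gt0.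
have [W W1 hW] := nU x _ d20; have [W' W'1 hW'] := nV x _ d20.
have [u du] := exists_density (filterI W1 W'1).
have := hW u r (density_sub (@subIsetl _ _ _) du).
have := hW' u r (density_sub (@subIsetr _ _ _) du).
have Cu : Cc (translate r (rc \o u)).
  by apply: Cc_translate => //; exact: (density_Cc du).
rewrite -fU // -fV // => h1 h2.
apply: le_trans (rnorm_tri (bact (integrated_form mu q (BanachAction V)) (q (translate r (rc \o u))) x) _ _) _.
rewrite rnormBC; lra.
Qed.

(** If q f is close to a, then U(f) is small uniformly in U, so q f is small. *)
Lemma crossed_product_separation a :
  (forall U x, calR U -> bact (integrated_form mu q U) a x = 0) -> a = 0.
Proof.
move=> h; apply: rnorm_small => e e0; have e20 : 0 < e / 2 by rewrite divr_gt0.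
have [f Cf af] := q_dense a e20.
have : rnorm (q f) <= e / 2.
  apply: (q_norm_le) => //; first exact: ltW.
  move=> U x RU; have HT := integrated_form_crep RU.
  rewrite -(integrated_form_q RU) // -[X in rnorm X]subr0 -(h U x RU).
  rewrite -(crep_sub HT); apply: le_trans (crep_norm HT _ _) _.
  by rewrite ler_wpM2r ?rnorm_ge0 // rnormBC ltW.
have := rnorm_tri (q f) a 0; rewrite !subr0; lra.
Qed.

Lemma q_translate_continuous f : Cc f -> continuous (fun r => q (translate r f)).
Proof.
move=> Cf r; apply/cvg_rnormP => e e0; have e20 : 0 < e / 2 by rewrite divr_gt0.
have nr : \forall s \near r, L1norm (fun t => translate (r^-1 * s)%g f t - f t) <= e / 2.
  have := L1norm_translate_small Cf e20 => H.
  have c : (fun s : G => r^-1 * s)%g @ r --> (1%g : G).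
      by rewrite -(mulVg r); exact: continuous_mull.
    exact: (c _ H).
apply: filterS nr => s hs; apply: (@le_lt_trans _ _ (e / 2)); last by lra.
have Cr := Cc_translate r Cf; have Cs := Cc_translate s Cf.
rewrite rnormBC -(q_sub) //; apply: le_trans (q_le_L1 _) _.
  exact: Cc_sub.
have <- // : L1norm (translate r (fun t => translate (r^-1 * s)%g f t - f t)) =
  L1norm (fun t => translate s f t - translate r f t).
  congr haar_int; apply/funext => t; rewrite /translate invgM invgK -mulgA mulVKg.
  by [].
rewrite L1norm_translate //; apply: Cc_sub => //; exact: Cc_translate.
Qed.

(** Under the integrated form of U both sides become U(f) U(g): bounded operators
    commute with the integral, and U(translate r g) = U_r U(g). *)
Lemma q_convolution_integral f g : Cc f -> Cc g ->
  bmul (q f) (q g) = vector_integral mu (fun r => f r *: q (translate r g)).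
Proof.
move=> Cf0 Cg; have /(CcP)[C cC Cf] := Cf0.
have CF : vcont_supp C (fun r => f r *: q (translate r g)).
  split=> [s|s ns]; last by rewrite Cf.2 // scale0r.
  by apply: cvgZ; [exact: Cf.1 | exact: q_translate_continuous].
apply/eqP; rewrite -subr_eq0; apply/eqP; apply: crossed_product_separation => U x RU.
have HT := integrated_form_crep RU.
have Tq := integrated_form_q RU.
rewrite (crep_sub HT) -(q_conv) // Tq; last exact: Cc_convolution.
rewrite (vector_integral_bounded cC CF (crep_evaluation HT x)).
rewrite (integrated_convolution (calR_rep RU)) //.
apply/eqP; rewrite subr_eq0; apply/eqP; congr vector_integral; apply/funext => r.
rewrite -[RHS]/(bact (integrated_form mu q U) (f r *: q (translate r g)) x).
rewrite (crep_scale HT) Tq; last exact: Cc_translate.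
by rewrite (integrated_translate (calR_rep RU)).
Qed.

Lemma density_L1norm V u r : density V u -> L1norm (translate r (rc \o u)) = 1.
Proof.
move=> du; rewrite L1norm_translate //; last exact: (density_Cc du).
have [C [_ _ _ u0 <-]] := du; congr haar_int; apply/funext => s.
by rewrite /= sabs_rc ger0_norm.
Qed.

Lemma q_density_le1 V u r : density V u -> rnorm (q (translate r (rc \o u))) <= 1.
Proof.
move=> du; rewrite -(density_L1norm r du); apply: (q_le_L1).
by apply: Cc_translate => //; exact: (density_Cc du).
Qed.

(** Under U, the difference is U_r (U(u) y - y) with y = U(f) x, and
    U_s y - y = U(translate s f - f) x is small for s near 1 by the L1-continuity
    of translation, uniformly in U and r. *)
Lemma approximate_unit f e : Cc f -> 0 < e ->
  exists2 V, nbhs (1%g : G) V & forall u r, density V u ->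
    rnorm (bmul (q (translate r (rc \o u))) (q f) - q (translate r f)) <= e.
Proof.
move=> Cf e0.
exists [set r | L1norm (fun s => translate r f s - f s) <= e].
  exact: L1norm_translate_small.
move=> u r du; have Cu := density_Cc du.
have Cru := Cc_translate r Cu.
have Crf := Cc_translate r Cf.
have Cc1 : Cc (convolution mu (translate r (rc \o u)) f) by exact: Cc_convolution.
rewrite -(q_conv) // -(q_sub) //.
apply: (q_norm_le); [exact: ltW | exact: Cc_sub | move=> U x RU].
have HU := calR_rep RU.
rewrite (integrated_subf HU) // (integrated_convolution HU) //.
rewrite !(integrated_translate HU) // -(linear_sub (rep_linear HU r)) (rep_norm HU).
have [C [cC CV Cu' u0 u1]] := du.
apply: (integrated_near_one HU cC Cu' u0 u1) => s /CV /= hs.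
rewrite -(integrated_translate HU) //.
have Cs := Cc_translate s Cf.
rewrite -(integrated_subf HU) //.
apply: le_trans (integrated_norm HU _ (Cc_sub Cs Cf)) _.
by rewrite ler_wpM2r ?rnorm_ge0.
Qed.

Section Given.
Variables (X : completeNormedModType K) (T : A -> X -> X).
Hypothesis HT : contractive_rep T.
Hypothesis ndT : Defs.nondegenerate T.

(** Non-degeneracy as an induction principle: by density of the image of q, it is
    enough to treat the vectors T (q f) x. *)
Lemma cyclic_closed (Y : set X) : closed Y -> linear_subspace Y ->
  (forall f x, Cc f -> Y (T (q f) x)) -> forall y, Y y.
Proof.
move=> cY [Y0 YD] YT y.
have YTa a x : Y (T a x).
  apply: closed_rnorm => // e e0; have x0 := rnorm_ge0 x.
  have x1 : 0 < rnorm x + 1 by lra.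
  have d0 : 0 < e / (rnorm x + 1) by rewrite divr_gt0.
  have [f Cf] := q_dense a d0; rewrite ltr_pdivlMr // => h.
  exists (T (q f) x); first exact: YT.
  rewrite -(crep_sub HT); apply: le_lt_trans (crep_norm HT _ _) _.
  by have := rnorm_ge0 (a - q f); lra.
apply: closed_rnorm => // e e0.
have [z [n [c [v [vT ->]]]] yz] := iffLR (dense_rnormP _) ndT y e e0.
exists (\sum_(i < n) c i *: v i) => //.
apply: (big_ind Y) => // [u w Yu Yw|i _].
  by rewrite -[u]scale1r; exact: YD.
by rewrite -[_ *: _]addr0; apply: YD => //; have [a [x ->]] := vT i.
Qed.

Lemma eq_on_cyclic (F F' : X -> X) M M' : linear F -> linear F' ->
  (forall x, rnorm (F x) <= M * rnorm x) -> (forall x, rnorm (F' x) <= M' * rnorm x) ->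
  (forall f x, Cc f -> F (T (q f) x) = F' (T (q f) x)) -> forall y, F y = F' y.
Proof.
move=> lF lF' FM FM' h.
apply: (@cyclic_closed [set y | F y = F' y]) => //; last first.
  split; first by rewrite /= !linear_0.
  by move=> c x y /= xx yy; rewrite lF lF' xx yy.
have cF : continuous F.
  by apply: (@bounded_continuous _ _ _ _ _ M) => u v; rewrite -(linear_sub lF).
have cF' : continuous F'.
  by apply: (@bounded_continuous _ _ _ _ _ M') => u v; rewrite -(linear_sub lF').
have -> : [set y | F y = F' y] = (fun y => F y - F' y) @^-1` [set 0].
  apply/seteqP; split=> y /=; first by move=> ->; rewrite subrr.
  by move/eqP; rewrite subr_eq0 => /eqP.
apply: preimage_closed; first by move=> y _; apply: cvgB; [exact: cF | exact: cF'].
apply: accessible_closed_set1; apply: hausdorff_accessible; exact: norm_hausdorff.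
Qed.

(** y' is the limit of T (q u_r) y as the density u concentrates at 1. Defining
    U_r y as a limit, rather than by the formula for U_r (T (q f) x), leaves no
    well-definedness to check on sums of such vectors. *)
Let lim r y y' := forall e, 0 < e -> exists2 V, nbhs (1%g : G) V &
  forall u, density V u -> rnorm (T (q (translate r (rc \o u))) y - y') <= e.

Let lim_lin r c y y' z z' : lim r y y' -> lim r z z' -> lim r (c *: y + z) (c *: y' + z').
Proof.
move=> hy hz e e0.
have c1 : 0 < sabs c + 1 by have := sabs_ge0 c; lra.
have d0 : 0 < e / 2 / (sabs c + 1) by rewrite !divr_gt0.
have e20 : 0 < e / 2 by rewrite divr_gt0.
have [V V1 hV] := hy _ d0; have [W W1 hW] := hz _ e20.
exists (V `&` W); first exact: filterI.
move=> u du; have {}hV := hV u (density_sub (@subIsetl _ _ _) du).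
have {}hW := hW u (density_sub (@subIsetr _ _ _) du).
rewrite (crep_linear HT) opprD addrACA -scalerBr.
apply: le_trans (rnormD _ _) _; rewrite rnormZ.
move: hV; rewrite ler_pdivlMr // => hV.
have := rnorm_ge0 (T (q (translate r (rc \o u))) y - y').
lra.
Qed.

(** The elements q u_r lie in the unit ball of A. *)
Let lim_le r y y' : lim r y y' -> rnorm y' <= rnorm y.
Proof.
move=> h; apply/ler_addgt0Pr => e e0; have [V V1 hV] := h e e0.
have [u du] := exists_density V1.
have := hV u du; have := crep_norm HT (q (translate r (rc \o u))) y.
have := ler_wpM2r (rnorm_ge0 y) (q_density_le1 r du); rewrite mul1r.
have := rnorm_tri (T (q (translate r (rc \o u))) y) y' 0; rewrite !subr0 rnormBC; lra.
Qed.

Let lim_sub r y y' z z' : lim r y y' -> lim r z z' -> rnorm (y' - z') <= rnorm (y - z).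
Proof.
move=> hy hz; apply: (@lim_le r).
have subE (u v : X) : u - v = -1 *: v + u by rewrite scaleN1r addrC.
rewrite !subE; exact: lim_lin.
Qed.

Let lim_unique r y y' y'' : lim r y y' -> lim r y y'' -> y' = y''.
Proof.
move=> h1 h2; have := lim_sub h1 h2; rewrite subrr rnorm0 => h.
apply/eqP; rewrite -subr_eq0; apply/eqP; apply: rnorm_eq0.
by apply/eqP; rewrite eq_le h rnorm_ge0.
Qed.

Let lim_q r f x : Cc f -> lim r (T (q f) x) (T (q (translate r f)) x).
Proof.
move=> Cf e e0; have x0 := rnorm_ge0 x; have x1 : 0 < rnorm x + 1 by lra.
have d0 : 0 < e / (rnorm x + 1) by rewrite divr_gt0.
have [V V1 hV] := approximate_unit Cf d0; exists V => // u du.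
rewrite -(crep_mul HT) -(crep_sub HT); apply: le_trans (crep_norm HT _ _) _.
have := hV u r du; rewrite ler_pdivlMr //.
have := rnorm_ge0 (bmul (q (translate r (rc \o u))) (q f) - q (translate r f)); lra.
Qed.

(** The set of vectors with a limit is a subspace, and it is closed because the
    limit is a contraction and X is complete. *)
Let lim_exists r y : exists y', lim r y y'.
Proof.
apply: (@cyclic_closed [set y | exists y', lim r y y']); last first.
- by move=> f x Cf; exists (T (q (translate r f)) x); exact: lim_q.
- split=> [|c x z [x' hx] [z' hz]]; last by exists (c *: x' + z'); exact: lim_lin.
  by exists 0 => e e0; exists setT => [|u _]; [exact: filterT|];
    rewrite (linear_0 (crep_linear HT _)) subrr rnorm0 ltW.
move=> z cz.
have near_z e : 0 < e -> exists2 w, (exists w', lim r w w') & rnorm (z - w) < e.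
  move=> e0; have nz : nbhs z [set w | rnorm (z - w) < e] by apply/nbhs_rnormP; exists e.
  by have [w [hw zw]] := cz _ nz; exists w.
have [||l lP] := @complete_approx R k X
  (fun e => [set w' | exists2 w, lim r w w' & rnorm (z - w) <= e]).
- move=> e e0; have [w [w' hw] zw] := near_z e e0.
  by exists w', w => //; exact: ltW.
- move=> e e' w' v' e0 e'0 [w hw zw] [v hv zv].
  apply: le_trans (lim_sub hw hv) _; have := rnorm_tri z w v.
  by rewrite (rnormBC w z); lra.
exists l => e e0; have e30 : 0 < e / 3 by rewrite divr_gt0.
have [w [w' hw] /ltW zw] := near_z _ e30.
have wl : rnorm (w' - l) <= e / 3 by apply: lP => //; exists w.
have [V V1 hV] := hw _ e30; exists V => // u du; have {}hV := hV u du.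
set t := T _ in hV *.
have lt : linear t by exact: crep_linear.
have tzw : rnorm (t z - t w) <= rnorm (z - w).
  rewrite -(linear_sub lt); apply: le_trans (crep_norm HT _ _) _.
  by rewrite ler_piMl ?rnorm_ge0 // (q_density_le1 _ du).
have := rnorm_tri (t w) (t z) l; have := rnorm_tri w' (t w) l; lra.
Qed.

Let U r y : X := projT1 (cid (lim_exists r y)).
Let UP r y : lim r y (U r y). Proof. exact: (projT2 (cid (lim_exists r y))). Qed.

Let U_linear r : linear (U r).
Proof. by move=> c x y; apply: lim_unique (UP _ _) _; exact: lim_lin. Qed.

Let U_le r y : rnorm (U r y) <= rnorm y.
Proof. exact: lim_le (UP r y). Qed.

Let U_q r f x : Cc f -> U r (T (q f) x) = T (q (translate r f)) x.
Proof. by move=> Cf; apply: lim_unique (UP _ _) _; exact: lim_q. Qed.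

Let comp_linear (f g : X -> X) : linear f -> linear g -> linear (f \o g).
Proof. by move=> lf lg c x y; rewrite /= lg lf. Qed.

Let U_mul r s y : U (r * s)%g y = U r (U s y).
Proof.
apply: (@eq_on_cyclic (U (r * s)%g) (U r \o U s) 1 1) => //.
- exact: comp_linear.
- by move=> x; rewrite mul1r.
- by move=> x; rewrite mul1r; exact: le_trans (U_le _ _) (U_le _ _).
- move=> f x Cf; rewrite /= !U_q //; last exact: Cc_translate.
  by rewrite translateM.
Qed.

Let U_one y : U 1%g y = y.
Proof.
apply: (@eq_on_cyclic (U 1%g) id 1 1) => //.
- by move=> x; rewrite mul1r.
- by move=> x; rewrite mul1r.
- move=> f x Cf; rewrite U_q //; congr (T (q _) x).
  by apply/funext => s; rewrite /translate invg1 mul1g.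
Qed.

(** Both U_r and its inverse are contractions. *)
Let U_norm r y : rnorm (U r y) = rnorm y.
Proof.
apply/eqP; rewrite eq_le U_le /=.
by have := U_le r^-1%g (U r y); rewrite -U_mul mulVg U_one.
Qed.

Let U_near_one y e : 0 < e -> \forall s \near (1%g : G), rnorm (U s y - y) <= e.
Proof.
move: y e; apply: (@cyclic_closed [set y | forall e, 0 < e ->
  \forall s \near (1%g : G), rnorm (U s y - y) <= e]).
- move=> z cz e e0; have e30 : 0 < e / 3 by rewrite divr_gt0.
  have nz : nbhs z [set w | rnorm (z - w) < e / 3] by apply/nbhs_rnormP; exists (e / 3).
  have [w [hw /= zw]] := cz _ nz.
  apply: filterS (hw _ e30) => s hs.
  have h1 : rnorm (U s z - U s w) = rnorm (z - w) by rewrite -(linear_sub (U_linear s)) U_norm.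
  have := rnorm_tri (U s w) (U s z) z; have := rnorm_tri w (U s w) z.
  rewrite (rnormBC w z); lra.
- split=> [e e0|c x y hx hy e e0].
    by apply: filterE => s; rewrite (linear_0 (U_linear s)) subrr rnorm0 ltW.
  have c1 : 0 < sabs c + 1 by have := sabs_ge0 c; lra.
  have d0 : 0 < e / 2 / (sabs c + 1) by rewrite !divr_gt0.
  have e20 : 0 < e / 2 by rewrite divr_gt0.
  apply: filterS2 (hx _ d0) (hy _ e20) => s; rewrite ler_pdivlMr // => h1 h2.
  rewrite U_linear opprD addrACA -scalerBr.
  apply: le_trans (rnormD _ _) _; rewrite rnormZ.
  have := rnorm_ge0 (U s x - x); lra.
- move=> f x Cf e e0; have x0 := rnorm_ge0 x; have x1 : 0 < rnorm x + 1 by lra.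
  have d0 : 0 < e / (rnorm x + 1) by rewrite divr_gt0.
  apply: filterS (L1norm_translate_small Cf d0) => s.
  rewrite ler_pdivlMr // => hs; have Cs := Cc_translate s Cf.
  rewrite U_q // -(crep_sub HT) -(q_sub) //.
  apply: le_trans (crep_norm HT _ _) _.
  have := ler_wpM2r x0 (q_le_L1 (Cc_sub Cs Cf)).
  have : 0 <= L1norm (fun s' => translate s f s' - f s') by exact: L1norm_ge0.
  lra.
Qed.

Let U_bounded r : bounded_operator (U r).
Proof.
apply/bounded_operatorP; split; first exact: U_linear.
by exists 1 => [|x]; [exact: ler01 | rewrite mul1r].
Qed.

Let U_iso : isometric_rep U.
Proof.
split.
- split; last by move=> r s; apply/funext => x; exact: U_mul.
  move=> r; split=> //; exists (U r^-1%g) => //.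
  by split=> x; rewrite -U_mul ?mulVg ?mulgV U_one.
- by move=> r x; rewrite !normE U_norm.
- move=> x r; apply/cvg_rnormP => e e0; have e20 : 0 < e / 2 by rewrite divr_gt0.
  have nr : \forall s \near r, rnorm (U (r^-1 * s)%g x - x) <= e / 2.
    have := U_near_one x e20 => H.
    have c : (fun s : G => r^-1 * s)%g @ r --> (1%g : G).
      by rewrite -(mulVg r); exact: continuous_mull.
    exact: (c _ H).
  apply: filterS nr => s hs; rewrite rnormBC -(U_norm r^-1%g) (linear_sub (U_linear _)).
  by rewrite -!U_mul mulVg U_one; lra.
Qed.

Hypothesis calX_X : calX X.

(** On T (q g) x, the operator U(f) gives the integral of
    f(r) T (q (translate r g)) x, which is T applied to q f * q g by
    q_convolution_integral. *)
Lemma integrated_form_surj : exists2 V, calR V & integrated_form mu q V = BanachAction T.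
Proof.
have RU : calR (BanachAction U) by have [h1 h2 h3] := U_iso; split.
exists (BanachAction U) => //.
rewrite /integrated_form; congr BanachAction.
apply: (integrated_form_unique RU HT) => f Cf.
apply/funext => y; symmetry.
apply: (@eq_on_cyclic (IO (BanachAction U) f) (T (q f)) (rnorm (q f)) (rnorm (q f))).
- exact: (integrated_linear U_iso).
- exact: crep_linear.
- by move=> x; exact: (integrated_le_q).
- exact: crep_norm.
move=> g x Cg; rewrite -(crep_mul HT) q_convolution_integral //.
have /(CcP)[C cC Cf'] := Cf.
have CF : vcont_supp C (fun r => f r *: q (translate r g)).
  split=> [s|s ns]; last by rewrite Cf'.2 // scale0r.
  by apply: cvgZ; [exact: Cf'.1 | exact: q_translate_continuous].
rewrite (vector_integral_bounded cC CF (crep_evaluation HT x)).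
congr vector_integral; apply/funext => r /=.
by rewrite (crep_scale HT) U_q.
Qed.
End Given.

End CrossedProduct.

Theorem theorem9p8 (R : realType) (k : scalar_kind)
    (G : topologicalGroupType)
    (G_hausdorff : hausdorff_space G) (G_lc : locally_compact [set: G])
    (mu : {measure set (borel G) -> \bar R}) (mu_haar : left_haar_measure mu)
    (calX : completeNormedModType (scalar_field R k) -> Prop)
    (calX_neq0 : exists X, calX X)
    (A : banachAlgebraType (scalar_field R k)) (q : (G -> scalar_field R k) -> A)
    (Aq : is_crossed_product mu (isometric_representations calX) q) :
  [/\ [/\ forall U, isometric_representations calX U ->
            nondegenerate_contractive_representations calX (integrated_form mu q U),
          forall U V, isometric_representations calX U ->
            isometric_representations calX V ->
            integrated_form mu q U = integrated_form mu q V -> U = V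
        & forall T, nondegenerate_contractive_representations calX T ->
            exists2 U, isometric_representations calX U &
              integrated_form mu q U = T],
      forall U, isometric_representations calX U ->
        closed_invariant_subspaces (integrated_form mu q U) =
        closed_invariant_subspaces U
    & forall U V, isometric_representations calX U ->
        isometric_representations calX V ->
        bounded_intertwiners (integrated_form mu q U) (integrated_form mu q V) =
        bounded_intertwiners U V].
Proof.
split; first split.
- by move=> U RU; exact: (integrated_form_representation G_hausdorff G_lc mu_haar Aq).
- by move=> U V; exact: (integrated_form_inj G_hausdorff G_lc mu_haar Aq).
- move=> [X T] [/= XX aT nT cT].
  exact: (integrated_form_surj G_hausdorff G_lc mu_haar Aq (conj aT cT) nT XX).
- by move=> U RU; exact: (integrated_form_subspaces G_hausdorff G_lc mu_haar Aq).
- by move=> U V RU RV; exact: (integrated_form_intertwiners G_hausdorff G_lc mu_haar Aq).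
Qed.
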